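(* Let $G_n=(\mathcal V,\mathcal E)$ be a graph of order $n$ with vertex set $\mathcal V=\{v_1,v_2,\ldots,v_n\}$ and edge set $\mathcal E$, let $h^e_{ij}:=\mathbf I(v_iv_j\in\mathcal E)$, let $p_e(i,j):=P(v_iv_j\in\mathcal E)$ for $i\neq j$, and let $\rho_e(G_n)=\frac{2|\mathcal E|}{n(n-1)}$. (a) If the set $\mathcal E$ of edges results from a random process, then $\rho_e(G_n)$ is a one-sample $U$-statistic of degree 2. Moreover, if $p_e(i,j)=p_e$ for all $i\neq j$, $i,j=1,2,\ldots,n$ (i.e., the edge probability is constant over pairs of vertices), then $\rho_e(G_n)$ is an unbiased estimator of $p_e$. (b) Suppose the set $\mathcal E$ of edges results from a random process such that the $h^e_{ij}$ are identically distributed with $p_e(i,j)=p_e$ for all $i\neq j$, $i,j=1,\ldots,n$; $h^e_{ij}$ and $h^e_{kl}$ are independent for distinct $i,j,k,l$; and $\nu_e:=\mathbf{Cov}(h^e_{ij},h^e_{ik})>0$ for all distinct $i,j,k\in\{1,\ldots,n\}$. Then $$\sqrt n\,\bigl[\rho_e(G_n)-p_e\bigr]\stackrel{\mathcal L}{\longrightarrow}\mathcal N(0,4\,\nu_e)\quad\text{as } n\to\infty .$$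
   Context: $\mathbf I(\cdot)$ is the indicator function and $|\cdot|$ denotes cardinality. Edges are unordered pairs of distinct vertices, so $v_iv_j=v_jv_i$ and $h^e_{ij}=h^e_{ji}$. The relative edge density $\rho_e(G_n)$ is the ratio of the number of edges of $G_n$ to the number of edges of the complete graph of order $n$. ''$\mathcal E$ results from a random process'' means that $\mathcal E$ is random, so $G_n$ is a random graph. ''One-sample $U$-statistic of degree 2'' is used in the sense that the statistic equals $\binom n2^{-1}\sum_{i<j}h_{ij}$ with a symmetric kernel ($h_{ij}=h_{ji}$), here $h_{ij}=h^e_{ij}$. $\stackrel{\mathcal L}{\longrightarrow}$ denotes convergence in law and $\mathcal N(\mu,\sigma^2)$ the normal distribution with mean $\mu$ and variance $\sigma^2$. In (b), $p_e$ and $\nu_e$ are constants that depend neither on the indices nor on $n$.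
   Formalization: In (b), independence of h_ij and h_kl is required jointly: all h_ij with i,j in U are independent of all h_kl with k,l in V for disjoint U, V. Pairwise independence alone is not enough: mixing G(n,1/4) with h_ij=X_iX_j, X_i i.i.d. Bernoulli(1/2), gives a non-normal limit. *)

(* Defs.v *)
From HB Require Import structures.
From mathcomp Require Import all_boot all_order all_algebra.
From mathcomp Require Import all_classical all_reals all_analysis.

Set Implicit Arguments.
Unset Strict Implicit.
Unset Printing Implicit Defensive.

Import Order.TTheory GRing.Theory Num.Theory.
Import numFieldNormedType.Exports.

Local Open Scope classical_set_scope.
Local Open Scope ring_scope.

(* The vertices are 'I_n and an edge is a two-element set of vertices. The edge
   set is a random element of the finite type {set {set 'I_n}}, which carries
   the discrete sigma-algebra. *)
Record random_graph (d : measure_display) (T : measurableType d) (n : nat) :=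
  RandomGraph {
    edges :> T -> {set {set 'I_n}};
    edges_card2 : forall w e, e \in edges w -> #|e| = 2%N;
    edges_measurable : forall F : set {set {set 'I_n}},
      measurable (edges @^-1` F) }.

Section EdgeStatistics.
Context (d : measure_display) (T : measurableType d) (R : realType) (n : nat).
Implicit Types (P : probability T R) (G : random_graph T n).

Definition edge_event G (i j : 'I_n) : set T :=
  [set w | [set i; j]%SET \in G w].

Definition edge_indicator G (i j : 'I_n) (w : T) : R :=
  \1_(edge_event G i j) w.

Definition edge_prob P G (i j : 'I_n) : \bar R := P (edge_event G i j).

Definition edge_density G (w : T) : R :=
  (2 * #|G w|)%:R / (n%:R * (n%:R - 1)).

Definition is_ustatistic2 (h : 'I_n -> 'I_n -> T -> R) (S : T -> R) :=
  [/\ forall i j, i != j -> measurable_fun [set: T] (h i j),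
      forall i j, i != j -> h i j = h j i
    & forall w,
        S w = ('C(n, 2)%:R)^-1 * \sum_(i < n) \sum_(j < n | (i < j)%N) h i j w].

Definition unbiased_estimator P (S : T -> R) (theta : R) :=
  measurable_fun [set: T] S /\ ('E_P[S] = theta%:E)%E.

Definition identically_distributed P (X Y : T -> R) :=
  forall B : set R, measurable B -> P (X @^-1` B) = P (Y @^-1` B).

Definition sigma_family (I : Type) (D : set I) (X : I -> T -> R) :
    set (set T) :=
  <<s \bigcup_(i in D) preimage_set_system [set: T] (X i) measurable >>.

Definition independent_families P (I J : Type) (D : set I) (X : I -> T -> R)
    (E : set J) (Y : J -> T -> R) :=
  forall A B, sigma_family D X A -> sigma_family E Y B ->
    P (A `&` B) = (P A * P B)%E.

Definition pairs_in (U : {set 'I_n}) : set ('I_n * 'I_n) :=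
  [set ij | [/\ ij.1 \in U, ij.2 \in U & ij.1 != ij.2]].

(* Independence of h_ij and h_kl for distinct i, j, k, l is read jointly, as
   dissociation of the array h: the h_ij with i, j in U are independent of the
   h_kl with k, l in V whenever U and V are disjoint. Independence of each
   single h_ij from each single h_kl is the case #|U| = #|V| = 2. That case
   alone does not imply the central limit theorem: it holds for a mixture of two
   dissociated graphs with the same edge probability and different covariances,
   where the limit is a mixture of normal laws. *)
Definition disjoint_edges_independent P G :=
  forall U V : {set 'I_n}, (U :&: V = finset.set0)%SET ->
    independent_families P
      (pairs_in U) (fun ij => edge_indicator G ij.1 ij.2)
      (pairs_in V) (fun kl => edge_indicator G kl.1 kl.2).

End EdgeStatistics.

Arguments edge_indicator {d T} R {n} G i j w.
Arguments edge_density {d T} R {n} G w.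

(* The variables X n may live on different probability spaces. *)
Definition cvg_in_law (R : realType) (d : nat -> measure_display)
    (T : forall n, measurableType (d n)) (P : forall n, probability (T n) R)
    (X : forall n, T n -> R) (Q : set R -> \bar R) :=
  (forall n, measurable_fun [set: T n] (X n)) /\
  forall x : R, {for x, continuous (fun y : R => Q `]-oo, y]%classic)} ->
    (fun n => P n (X n @^-1` `]-oo, x]%classic)) @ \oo --> Q `]-oo, x]%classic.

(* Main.v *)
Require Import Defs.
From mathcomp Require Import all_boot all_order all_algebra.
From mathcomp Require Import all_classical all_reals all_analysis.
From mathcomp Require Import measurable_realfun.
From mathcomp Require Import ring lra zify.

Set Implicit Arguments.
Unset Strict Implicit.
Unset Printing Implicit Defensive.

Import Order.TTheory GRing.Theory Num.Theory.
Import numFieldNormedType.Exports.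

(** Part (a) is counting: a graph without loops is determined by its edges
    [{i, j}] with [i < j], so the density is the mean of the indicators [h_ij]
    over these pairs, and linearity of the expectation gives the bias.

    Part (b) is proved by Stein's method. Put [X_ij = h_ij - p], with
    [X_ii = 0]; the normalised density is [W = b * \sum_(i, j) X_ij], where
    [b = sqrt n / (n (n - 1))] is of order [n ^ (- 3 / 2)]. The edge set takes
    finitely many values, so every expectation below is a finite sum
    ([expectation_law]).

    The array [X] is dissociated: [X_ij] is independent of the part of [W] that
    avoids the vertices [i] and [j]. The remaining part [D_ij] has at most [4 n]
    terms, hence is of order [b n]. As [X_ij] is centred, a Taylor expansion of
    [f] at [W] gives
      [E (W f(W)) = E (f'(W) T) + O(b ^ 3 n ^ 4)], [T = b \sum_(i, j) X_ij D_ij]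
    ([stein_expansion]). Up to a negligible term, [T] is [4 b ^ 2] times the sum
    over the wedges [(i, j, k)] of [X_ij X_ik]. Its mean tends to [4 nu]
    ([expect_sumsq]), and since only [O(n ^ 5)] pairs of wedges share a vertex
    its variance is [O(1 / n)] ([sumsq_variance]). Therefore
      [E (W f(W)) - 4 nu E (f'(W)) --> 0]
    for every [f] whose derivative is bounded and Lipschitz ([stein_bound]).

    With [s ^ 2 = 4 nu], the equation [s ^ 2 f' - x f = g] has such a solution
    for every Lipschitz [g] with compact support and normal mean zero
    ([stein_equation]), so [E (g(W)) --> 0]. The second moments of [W] are
    bounded (take [f = id]), which prevents mass from escaping to infinity: the
    condition that [g] has mean zero is removed by subtracting a multiple of a
    wide trapezoid ([lipschitz_compact_cvg]), and half-lines are then compared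
    with trapezoids ([cdf_upper], [cdf_lower]) to reach the distribution
    functions ([stein_cvg_cdf]). *)

(** * Expectation on a finite space *)

Local Open Scope ring_scope.

Section FiniteExpectation.
Context (R : rcfType) (Om : finType) (q : Om -> R).

Definition expect (Y : Om -> R) : R := \sum_w q w * Y w.

Definition is_distribution := (forall w, 0 <= q w) /\ \sum_w q w = 1.

Lemma eq_expect Y Z : Y =1 Z -> expect Y = expect Z.
Proof. by move=> YZ; apply: eq_bigr => w _; rewrite YZ. Qed.

Lemma expectD Y Z : expect (fun w => Y w + Z w) = expect Y + expect Z.
Proof. by rewrite -big_split; apply: eq_bigr => w _; rewrite mulrDr. Qed.

Lemma expectZ c Y : expect (fun w => c * Y w) = c * expect Y.
Proof. by rewrite mulr_sumr; apply: eq_bigr => w _; rewrite mulrCA. Qed.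

Lemma expectB Y Z : expect (fun w => Y w - Z w) = expect Y - expect Z.
Proof. by rewrite -sumrB; apply: eq_bigr => w _; rewrite mulrBr. Qed.

Lemma expect_sum (I : Type) (r : seq I) (C : pred I) (Y : I -> Om -> R) :
  expect (fun w => \sum_(i <- r | C i) Y i w) = \sum_(i <- r | C i) expect (Y i).
Proof. by rewrite exchange_big; apply: eq_bigr => w _; rewrite mulr_sumr. Qed.

Hypothesis qP : is_distribution.

Lemma expect_cst c : expect (fun=> c) = c.
Proof. by rewrite /expect -mulr_suml qP.2 mul1r. Qed.

Lemma le_expect Y Z : (forall w, Y w <= Z w) -> expect Y <= expect Z.
Proof. by move=> YZ; apply: ler_sum => w _; rewrite ler_wpM2l ?qP.1. Qed.

Lemma norm_expect Y : `|expect Y| <= expect (fun w => `|Y w|).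
Proof.
apply: (le_trans (ler_norm_sum _ _ _)); apply: ler_sum => w _.
by rewrite normrM (ger0_norm (qP.1 w)).
Qed.

Lemma norm_expect_le Y Z : (forall w, `|Y w| <= Z w) -> `|expect Y| <= expect Z.
Proof. by move=> YZ; exact: le_trans (norm_expect _) (le_expect YZ). Qed.

Lemma norm_expect_cst Y c : (forall w, `|Y w| <= c) -> `|expect Y| <= c.
Proof. by move=> Yc; rewrite -[leRHS]expect_cst; exact: norm_expect_le. Qed.

(** Jensen's inequality, from the nonnegative variance of [`|Y|]. *)
Lemma expect_norm_sqrt Y c : expect (fun w => Y w ^+ 2) <= c ->
  expect (fun w => `|Y w|) <= Num.sqrt c.
Proof.
move=> Yc; set m := expect (fun w => `|Y w|).
have m0 : 0 <= m by rewrite -(expect_cst 0); exact: le_expect.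
rewrite -(ger0_norm m0) -sqrtr_sqr ler_wsqrtr//; apply: le_trans Yc.
rewrite -subr_ge0.
have -> : expect (fun w => Y w ^+ 2) - m ^+ 2 =
    expect (fun w => (`|Y w| - m) ^+ 2).
  transitivity (expect (fun w => (Y w ^+ 2 - (2 * m) * `|Y w|) + m ^+ 2)).
    by rewrite expectD expectB expectZ expect_cst -/m; ring.
  by apply: eq_expect => w; rewrite sqrrB real_normK ?num_real//; ring.
by rewrite -(expect_cst 0); apply: le_expect => w; exact: sqr_ge0.
Qed.

(** Only pairs of dependent terms contribute to the variance of a sum, and each
    contributes at most 2. *)
Lemma variance_sum_le (I : finType) (dep : rel I) (Y : I -> Om -> R) :
  (forall i w, `|Y i w| <= 1) ->
  (forall i j, ~~ dep i j ->
    expect (fun w => Y i w * Y j w) = expect (Y i) * expect (Y j)) ->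
  expect (fun w => (\sum_i Y i w - \sum_i expect (Y i)) ^+ 2) <=
  2 * (\sum_i \sum_j dep i j)%N%:R.
Proof.
move=> Y1 Yind.
have -> : expect (fun w => (\sum_i Y i w - \sum_i expect (Y i)) ^+ 2) =
   \sum_i \sum_j (expect (fun w => Y i w * Y j w) - expect (Y i) * expect (Y j)).
  transitivity (expect (fun w => \sum_i \sum_j
      (Y i w - expect (Y i)) * (Y j w - expect (Y j)))).
    apply: eq_expect => w; rewrite -sumrB expr2 mulr_suml.
    by apply: eq_bigr => i _; rewrite mulr_sumr.
  rewrite expect_sum; apply: eq_bigr => i _.
  rewrite expect_sum; apply: eq_bigr => j _.
  transitivity (expect (fun w => (Y i w * Y j w - expect (Y i) * Y j w) +
      (expect (Y i) * expect (Y j) - expect (Y j) * Y i w))).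
    by apply: eq_expect => w; ring.
  by rewrite expectD !expectB !expectZ expect_cst; ring.
rewrite natr_sum mulr_sumr; apply: ler_sum => i _.
rewrite natr_sum mulr_sumr; apply: ler_sum => j _.
have [_|/Yind->] := boolP (dep i j); last by rewrite subrr mulr0.
rewrite mulr1; apply: le_trans (ler_norm _) _; apply: le_trans (ler_normB _ _) _.
apply: lerD.
  by apply: norm_expect_cst => w; rewrite normrM mulr_ile1.
by rewrite normrM mulr_ile1 ?norm_expect_cst.
Qed.

End FiniteExpectation.

(** * Stein's method for dissociated arrays *)

Section DissociatedArray.
Context (R : rcfType) (Om : finType) (q : Om -> R) (n : nat).
Variable X : 'I_n -> 'I_n -> Om -> R.

Definition depends_on (U : {set 'I_n}) (Y : Om -> R) :=
  forall w w', (forall i j, i \in U -> j \in U -> X i j w = X i j w') ->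
    Y w = Y w'.

Definition dissociated := forall U V Y Z, U :&: V = finset.set0 ->
  depends_on U Y -> depends_on V Z ->
  expect q (fun w => Y w * Z w) = expect q Y * expect q Z.

Hypothesis qP : is_distribution q.
Hypothesis Xsym : forall i j w, X i j w = X j i w.
Hypothesis Xdiag : forall i w, X i i w = 0.
Hypothesis X1 : forall i j w, `|X i j w| <= 1.
Hypothesis Xdis : dissociated.

Definition row_sum i w := \sum_j X i j w.
Definition total w := \sum_i \sum_j X i j w.

(** The part of the total carried by the ordered pairs meeting [{i, j}]: by
    symmetry the rows and the columns of [i] and [j] have the same sums, and
    [(i, j)] and [(j, i)] each lie in one of these rows and one of these columns. *)
Definition touching i j w := 2 * (row_sum i w + row_sum j w - X i j w).

Definition avoiding i j w :=
  \sum_(k in ~: [set i; j]) \sum_(l in ~: [set i; j]) X k l w.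

Lemma sum_setC2 (i j : 'I_n) (F : 'I_n -> R) : i != j ->
  \sum_k F k = F i + F j + \sum_(k in ~: [set i; j]) F k.
Proof.
move=> ij; rewrite (bigID (mem [set i; j])) /=; congr (_ + _).
  by rewrite (big_setU1 _) ?inE//= big_set1.
by apply: eq_bigl => k; rewrite !inE.
Qed.

Lemma total_split i j w : i != j -> total w = avoiding i j w + touching i j w.
Proof.
move=> ij; rewrite /total (sum_setC2 _ ij).
under [X in _ + X]eq_bigr do rewrite (sum_setC2 _ ij).
rewrite !big_split /= -/(avoiding i j w) -/(row_sum i w) -/(row_sum j w).
have sumE (a : 'I_n) : \sum_(k in ~: [set i; j]) X k a w =
    row_sum a w - X a i w - X a j w.
  rewrite /row_sum (sum_setC2 _ ij).
  under eq_bigr do rewrite Xsym.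
  by ring.
by rewrite !sumE !Xdiag (Xsym j i) /touching; ring.
Qed.

Lemma norm_row_sum_le i w : `|row_sum i w| <= n%:R.
Proof.
apply: le_trans (ler_norm_sum _ _ _) _.
apply: le_trans (ler_sum _ (fun j _ => X1 i j w)) _.
by rewrite sumr_const card_ord.
Qed.

Lemma touching_le i j w : `|touching i j w| <= 6 * n%:R.
Proof.
rewrite normrM ger0_norm// (_ : 6 * n%:R = 2 * (3 * n%:R)) ?ler_pM2l//; last by ring.
have n1 : 1 <= n%:R :> R by rewrite ler1n (leq_ltn_trans (leq0n i)).
have := norm_row_sum_le i w; have := norm_row_sum_le j w; have := X1 i j w.
rewrite !ler_norml => /andP[? ?] /andP[? ?] /andP[? ?].
by apply/andP; split; lra.
Qed.

Lemma sum_ij_le (F : 'I_n -> 'I_n -> R) (c : R) : (forall i j, `|F i j| <= c) ->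
  `|\sum_i \sum_j F i j| <= n%:R ^+ 2 * c.
Proof.
move=> Fc; rewrite pair_bigA /=; apply: le_trans (ler_norm_sum _ _ _) _.
apply: le_trans (ler_sum _ (fun ij _ => Fc ij.1 ij.2)) _.
by rewrite sumr_const card_prod card_ord mulnn -[leLHS]mulr_natl natrX.
Qed.

Lemma expect_avoiding (f : R -> R) i j : expect q (X i j) = 0 -> i != j ->
  expect q (fun w => X i j w * f (avoiding i j w)) = 0.
Proof.
move=> Xij0 ij; rewrite (@Xdis [set i; j] (~: [set i; j])) ?Xij0 ?mul0r//.
- exact: finset.setICr.
- by move=> w w' ww'; rewrite ww'// !inE eqxx ?orbT.
- move=> w w' ww'; congr f; apply: eq_bigr => k kU; apply: eq_bigr => l lU.
  exact: ww'.
Qed.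

Variable b : R.
Hypothesis b0 : 0 <= b.
Definition scaled_total w := b * total w.
Definition sumsq w := \sum_i (row_sum i w) ^+ 2.

(** Reduces the weight of [f'] in Stein's identity to the squared row sums, whose
    fluctuations are accessible through wedges; the other term is at most
    [2 * b ^ 2 * n ^ 2], hence negligible. *)
Lemma increment_sum w :
  b * \sum_i \sum_j X i j w * (b * touching i j w) =
  4 * b ^+ 2 * sumsq w - 2 * b ^+ 2 * \sum_i \sum_j X i j w ^+ 2.
Proof.
have E1 : \sum_i \sum_j X i j w * row_sum i w = sumsq w.
  by apply: eq_bigr => i _; rewrite -mulr_suml expr2.
have E2 : \sum_i \sum_j X i j w * row_sum j w = sumsq w.
  rewrite exchange_big; apply: eq_bigr => i _.
  by rewrite -mulr_suml expr2; under eq_bigr do rewrite Xsym.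
transitivity (\sum_i \sum_j (2 * b ^+ 2 * (X i j w * row_sum i w) +
   2 * b ^+ 2 * (X i j w * row_sum j w) - 2 * b ^+ 2 * (X i j w ^+ 2))).
  rewrite mulr_sumr; apply: eq_bigr => i _; rewrite mulr_sumr.
  by apply: eq_bigr => j _; rewrite /touching; ring.
transitivity (2 * b ^+ 2 * (\sum_i \sum_j X i j w * row_sum i w) +
   2 * b ^+ 2 * (\sum_i \sum_j X i j w * row_sum j w) -
   2 * b ^+ 2 * (\sum_i \sum_j X i j w ^+ 2)).
  rewrite !mulr_sumr -big_split -sumrB /=; apply: eq_bigr => i _.
  by rewrite !mulr_sumr -big_split -sumrB.
by rewrite E1 E2; ring.
Qed.

Hypothesis Xmean : forall i j, expect q (X i j) = 0.

(** With [D i j = b * touching i j], the variable [scaled_total - D i j] depends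
    only on the vertices other than [i] and [j], so its product with the centred
    [X i j] has mean zero after applying any [f]. What is left of
    [X i j * f scaled_total] is a Taylor expansion along [D i j]. *)
Lemma stein_expansion (f f' : R -> R) (C2 : R) :
  0 <= C2 ->
  (forall x y, `|f y - f x - f' x * (y - x)| <= C2 * (y - x) ^+ 2) ->
  `|expect q (fun w => scaled_total w * f (scaled_total w)) -
    expect q (fun w => f' (scaled_total w) *
      (4 * b ^+ 2 * sumsq w - 2 * b ^+ 2 * \sum_i \sum_j X i j w ^+ 2))| <=
  36 * C2 * b ^+ 3 * n%:R ^+ 4.
Proof.
move=> C20 ff'.
pose D i j w := b * touching i j w.
pose rem i j w := f (scaled_total w - D i j w) - f (scaled_total w)
  - f' (scaled_total w) * (scaled_total w - D i j w - scaled_total w).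
have -> : expect q (fun w => scaled_total w * f (scaled_total w)) -
    expect q (fun w => f' (scaled_total w) *
      (4 * b ^+ 2 * sumsq w - 2 * b ^+ 2 * \sum_i \sum_j X i j w ^+ 2)) =
    - b * \sum_i \sum_j expect q (fun w => X i j w * rem i j w).
  transitivity (expect q (fun w =>
      b * (\sum_i \sum_j X i j w * f (scaled_total w - D i j w)) -
      b * \sum_i \sum_j X i j w * rem i j w)).
    rewrite -expectB; apply: eq_expect => w; rewrite -increment_sum /scaled_total.
    rewrite {1}/total.
    rewrite mulrCA -[X in X - _]mulrA -!mulrBr; congr *%R.
    rewrite [X in X - _]mulr_suml [X in _ - X]mulr_sumr -!sumrB.
    apply: eq_bigr => i _.
    rewrite [X in X - _]mulr_suml [X in _ - X]mulr_sumr -!sumrB.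
    apply: eq_bigr => j _.
    by rewrite /rem -/(scaled_total w) -/(D i j w); ring.
  rewrite expectB !expectZ !expect_sum [X in b * X](_ : _ = 0); last first.
    apply: big1 => i _; rewrite expect_sum; apply: big1 => j _.
    have [<-|ij] := eqVneq i j.
      transitivity (expect q (fun=> 0)).
        by apply: eq_expect => w; rewrite Xdiag mul0r.
      exact: expect_cst.
    rewrite -(expect_avoiding (fun x => f (b * x)) (Xmean i j) ij).
    apply: eq_expect => w; congr (_ * f _).
    by rewrite /scaled_total (total_split w ij) /D; ring.
  by rewrite mulr0 sub0r mulNr; under eq_bigr do rewrite expect_sum.
rewrite normrM normrN (ger0_norm b0).
apply: le_trans (_ : b * (n%:R ^+ 2 * (C2 * (b * (6 * n%:R)) ^+ 2)) <= _);
  last by rewrite le_eqVlt; apply/orP; left; apply/eqP; ring.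
apply: ler_wpM2l => //; apply: sum_ij_le => i j; apply: norm_expect_cst => // w.
rewrite normrM -[leRHS]mul1r; apply: ler_pM => //.
apply: le_trans (ff' _ _) _; apply: ler_wpM2l => //.
rewrite addrAC subrr add0r sqrrN -real_normK ?num_real// ler_sqr ?nnegrE//; last first.
  by rewrite mulr_ge0// mulr_ge0.
by rewrite /D normrM (ger0_norm b0); apply: ler_wpM2l => //; exact: touching_le.
Qed.

(** A triple [(i, j, k)] stands for the wedge with centre [i] and ends [j], [k];
    the squared row sums add up the products of the entries along its two sides. *)
Definition wedge_support (t : 'I_n * 'I_n * 'I_n) : {set 'I_n} :=
  [set t.1.1; t.1.2; t.2]%SET.

Definition wedge (t : 'I_n * 'I_n * 'I_n) w := X t.1.1 t.1.2 w * X t.1.1 t.2 w.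

Lemma sumsqE w : sumsq w = \sum_t wedge t w.
Proof.
rewrite -(pair_bigA _ (fun ij k => X ij.1 ij.2 w * X ij.1 k w)) /=.
rewrite -(pair_bigA _ (fun i j => \sum_k X i j w * X i k w)) /=.
apply: eq_bigr => i _; rewrite expr2 /row_sum mulr_suml.
by apply: eq_bigr => j _; rewrite mulr_sumr.
Qed.

Lemma count_meeting (S : {set 'I_n}) : (#|S| <= 3)%N ->
  (\sum_u ~~ [disjoint S & wedge_support u] <= 9 * n ^ 2)%N.
Proof.
move=> S3; apply: (@leq_trans (\sum_(u : 'I_n * 'I_n * 'I_n)
    ((u.1.1 \in S) + (u.1.2 \in S) + (u.2 \in S)))).
  apply: leq_sum => -[[i j] k] _ /=.
  have [//|] := boolP [disjoint _ & _].
  rewrite -finset.setI_eq0 => /finset.set0Pn[x].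
  rewrite inE => /andP[xS]; rewrite !inE -orbA /=.
  by move=> /or3P[] /eqP <-; rewrite xS ?addn1 ?add1n ?addnS.
rewrite -(pair_bigA _ (fun ij k => (ij.1 \in S) + (ij.2 \in S) + (k \in S))%N) /=.
rewrite -(pair_bigA _ (fun i j => \sum_k ((i \in S) + (j \in S) + (k \in S)))%N) /=.
have cS : (\sum_(k : 'I_n) (k \in S) = #|S|)%N.
  by rewrite -sum1_card [RHS]big_mkcond; apply: eq_bigr => k _; case: (k \in S).
have -> : (\sum_(i < n) \sum_(j < n) \sum_(k < n)
    ((i \in S) + (j \in S) + (k \in S)) = 3 * #|S| * n ^ 2)%N.
  transitivity (\sum_(i < n) (n * n * (i \in S) + 2 * (n * #|S|)))%N.
    apply: eq_bigr => i _.
    transitivity (\sum_(j < n) (n * (i \in S) + n * (j \in S) + #|S|))%N.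
      by apply: eq_bigr => j _; rewrite big_split /= sum_nat_const cS card_ord mulnDr.
    by rewrite !big_split /= -!big_distrr /= cS !sum_nat_const card_ord; ring.
  by rewrite big_split /= -!big_distrr /= cS sum_nat_const card_ord; ring.
by rewrite leq_mul2r; apply/orP; right; lia.
Qed.

Lemma card_wedge_support t : (#|wedge_support t| <= 3)%N.
Proof.
rewrite /wedge_support; apply: leq_trans (leq_card_setU _ _) _.
by rewrite cards1 cards2; case: (_ != _).
Qed.

Lemma wedge_dep t : depends_on (wedge_support t) (wedge t).
Proof. by move=> w w' ww'; rewrite /wedge !ww' // !inE eqxx ?orbT. Qed.

Lemma norm_wedge t w : `|wedge t w| <= 1.
Proof. by rewrite normrM mulr_ile1. Qed.

(** Wedges with disjoint vertex sets are independent, and each wedge meets at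
    most [9 n ^ 2] wedges: three choices for the common vertex, three for the
    position where it occurs. *)
Lemma sumsq_variance :
  expect q (fun w => (sumsq w - expect q sumsq) ^+ 2) <= 18 * n%:R ^+ 5.
Proof.
pose dep t u := ~~ [disjoint wedge_support t & wedge_support u].
rewrite (eq_expect q sumsqE) expect_sum.
under eq_expect do rewrite sumsqE.
apply: le_trans (variance_sum_le (dep := dep) qP norm_wedge _) _ => [t u|].
  rewrite negbK => tu; apply: (Xdis _ (@wedge_dep t) (@wedge_dep u)).
  by apply/eqP; rewrite finset.setI_eq0.
rewrite (_ : 18 = 2 * 9); last by rewrite -natrM.
rewrite -mulrA ler_pM2l// -natrX -natrM ler_nat.
apply: (@leq_trans (\sum_(t : 'I_n * 'I_n * 'I_n) 9 * n ^ 2)).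
  by apply: leq_sum => t _; exact: count_meeting (card_wedge_support t).
by rewrite sum_nat_const !card_prod card_ord !expnS expn0; lia.
Qed.

Variable nu : R.
Hypothesis Xcov : forall i j k, i != j -> i != k -> j != k ->
  expect q (fun w => X i j w * X i k w) = nu.

(** Wedges on three distinct vertices contribute [nu] each; the other ones have
    [j = k], at most [n ^ 2] in number, or vanish with the diagonal. *)
Lemma expect_sumsq :
  `|expect q sumsq - nu * (n * n.-1 * n.-2)%:R| <= n%:R ^+ 2.
Proof.
pose nu3 (i j k : 'I_n) := [&& i != j, i != k & j != k].
have -> : expect q sumsq - nu * (n * n.-1 * n.-2)%:R =
    \sum_i \sum_j expect q (fun w => X i j w ^+ 2).
  apply/eqP; rewrite subr_eq addrC; apply/eqP.
  have -> : (n * n.-1 * n.-2)%:R = \sum_i \sum_j \sum_k (nu3 i j k)%:R :> R.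
    transitivity (\sum_(i < n) \sum_(j < n | j != i) (n.-2%:R : R)).
      under eq_bigr => i _.
        rewrite sumr_const (_ : #|_| = n.-1); last first.
          by rewrite (eq_card (B := predC1 i)) ?cardC1 ?card_ord.
        over.
      by rewrite sumr_const card_ord -!mulrnA; congr (_ *+ _); ring.
    apply: eq_bigr => i _; rewrite big_mkcond; apply: eq_bigr => j _.
    rewrite /nu3 eq_sym; case: eqVneq => [_|ij] /=; first by rewrite big1.
    rewrite -natr_sum; congr _%:R.
    transitivity #|~: [set i; j]%SET|.
      by rewrite cardsCs finset.setCK cards2 ij card_ord subn2.
    rewrite -sum1_card big_mkcond; apply: eq_bigr => k _.
    by rewrite !inE negb_or ![k == _]eq_sym; case: (i == k); case: (j == k).
  rewrite mulr_sumr -big_split expect_sum /=; apply: eq_bigr => i _.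
  rewrite mulr_sumr -big_split /=.
  transitivity (\sum_j \sum_k expect q (fun w => X i j w * X i k w)).
    transitivity (expect q (fun w => \sum_j \sum_k X i j w * X i k w)).
      apply: eq_expect => w; rewrite expr2 mulr_suml.
      by apply: eq_bigr => j _; rewrite mulr_sumr.
    by rewrite expect_sum; apply: eq_bigr => j _; rewrite expect_sum.
  apply: eq_bigr => j _; rewrite mulr_sumr.
  have -> : expect q (fun w => X i j w ^+ 2) =
      \sum_k (k == j)%:R * expect q (fun w => X i j w ^+ 2).
    rewrite (bigD1 j)//= eqxx mul1r big1 ?addr0// => k /negbTE ->.
    by rewrite mul0r.
  rewrite -big_split; apply: eq_bigr => k _ /=; rewrite /nu3.
  have [<-|ij] := eqVneq i j.
    rewrite mulr0 add0r; under eq_expect do rewrite Xdiag mul0r.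
    under [in RHS]eq_expect do rewrite Xdiag expr0n.
    by rewrite !(expect_cst qP) mulr0.
  rewrite (eq_sym k j); have [<-|jk] := eqVneq j k.
    rewrite ij mulr0 add0r mul1r.
    by apply: eq_expect => w; rewrite expr2.
  rewrite mul0r addr0; have [<-|ik] := eqVneq i k; last by rewrite mulr1 Xcov.
  rewrite mulr0; under eq_expect do rewrite Xdiag mulr0.
  exact: expect_cst.
rewrite -[leRHS]mulr1; apply: sum_ij_le => i j; apply: norm_expect_cst => // w.
by rewrite normrX exprn_ile1.
Qed.

(** The value of [b] is the scale at which [4 * b ^ 2 * (n * n.-1 * n.-2)] tends
    to 4. In terms of [h = sqrt n] it satisfies [b * h ^ 3 <= 2], and each error
    term is [O(1 / h)]: the Taylor remainder by [b ^ 3 * h ^ 8], the fluctuation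
    of the squared row sums by [b ^ 2 * h ^ 5], and the diagonal terms by
    [b ^ 2 * h ^ 4]. *)
Lemma stein_bound (f f' : R -> R) (C1 C2 : R) : (1 < n)%N ->
  b = Num.sqrt n%:R / (n%:R * (n%:R - 1)) ->
  (forall x, `|f' x| <= C1) -> 0 <= C2 ->
  (forall x y, `|f y - f x - f' x * (y - x)| <= C2 * (y - x) ^+ 2) ->
  `|expect q (fun w => scaled_total w * f (scaled_total w)) -
    4 * nu * expect q (fun w => f' (scaled_total w))| <=
  (288 * C2 + (104 + 8 * `|nu|) * C1) / Num.sqrt n%:R.
Proof.
move=> n1 bE f'C1 C20 ff'.
set h := Num.sqrt n%:R; rewrite -/h in bE.
have hh : n%:R = h ^+ 2 by rewrite sqr_sqrtr// ler0n.
have h1 : 1 <= h by rewrite -sqrtr1 ler_sqrt ?ler0n// ler1n ltnW.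
have h0 : 0 < h by exact: lt_le_trans h1.
have n2 : 2 <= h ^+ 2 by rewrite -hh ler_nat.
have C10 : 0 <= C1 by exact: le_trans (f'C1 0).
pose c := b * h ^+ 3.
have c0 : 0 <= c by rewrite mulr_ge0// exprn_ge0// ltW.
have c2 : c <= 2.
  have -> : c = h ^+ 2 / (h ^+ 2 - 1) by rewrite /c bE hh; field; lra.
  by rewrite ler_pdivrMr; lra.
have bc : b = c / h ^+ 3 by rewrite /c mulfK// expf_neq0// gt_eqF.
have hV : h^-1 * h = 1 by rewrite mulVf// gt_eqF.
have hV0 : 0 < h^-1 by rewrite invr_gt0.
have hV1 : h^-1 <= 1 by rewrite invf_le1.
have cc : c ^+ 2 <= 4 by nra.
have hV2 : h^-1 ^+ 2 <= h^-1 by nra.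
have b4 : b ^+ 2 * h ^+ 4 <= 4 / h.
  have -> : b ^+ 2 * h ^+ 4 = c ^+ 2 * h^-1 ^+ 2.
    by rewrite bc; field; rewrite gt_eqF.
  by apply: ler_pM => //; exact: sqr_ge0.
have b5 : b ^+ 2 * h ^+ 5 <= 4 / h.
  have -> : b ^+ 2 * h ^+ 5 = c ^+ 2 / h by rewrite bc; field; rewrite gt_eqF.
  by rewrite ler_pM2r.
have rem_le : 36 * C2 * b ^+ 3 * n%:R ^+ 4 <= 288 * C2 / h.
  have -> : 36 * C2 * b ^+ 3 * n%:R ^+ 4 = 36 * C2 * (c ^+ 3 / h).
    by rewrite hh bc; field; rewrite gt_eqF.
  have c3 : c ^+ 3 / h <= 8 / h by rewrite ler_pM2r//; nra.
  by apply: le_trans (ler_wpM2l _ c3) _; [rewrite mulr_ge0|lra].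
pose T w := 4 * b ^+ 2 * sumsq w - 2 * b ^+ 2 * \sum_i \sum_j X i j w ^+ 2.
have T_le : expect q (fun w => `|T w - 4 * nu|) <= (104 + 8 * `|nu|) / h.
  have sumX2 w : `|\sum_i \sum_j X i j w ^+ 2| <= h ^+ 4.
    rewrite (_ : h ^+ 4 = n%:R ^+ 2 * 1); last by rewrite hh; ring.
    by apply: sum_ij_le => i j; rewrite normrX exprn_ile1.
  have sumsq_dev : expect q (fun w => `|sumsq w - expect q sumsq|) <= 5 * h ^+ 5.
    apply: le_trans (expect_norm_sqrt qP sumsq_variance) _.
    rewrite -[leRHS]ger0_norm; last by rewrite mulr_ge0// exprn_ge0// ltW.
    rewrite -sqrtr_sqr; apply: ler_wsqrtr.
    have : 0 <= h ^+ 10 by rewrite exprn_ge0// ltW.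
    (* the constant 5 comes from 18 <= 5 ^ 2 *)
    have -> : 18 * n%:R ^+ 5 = 18 * h ^+ 10 by rewrite hh; ring.
    have -> : (5 * h ^+ 5) ^+ 2 = 25 * h ^+ 10 by ring.
    lra.
  have mean_dev : `|4 * b ^+ 2 * expect q sumsq - 4 * nu| <= (16 + 8 * `|nu|) / h.
    have -> : 4 * b ^+ 2 * expect q sumsq - 4 * nu =
        4 * b ^+ 2 * (expect q sumsq - nu * (n * n.-1 * n.-2)%:R) +
        4 * nu * (b ^+ 2 * (n * n.-1 * n.-2)%:R - 1) by ring.
    apply: le_trans (ler_normD _ _) _; rewrite [leRHS]mulrDl; apply: lerD.
      rewrite normrM ger0_norm; last by rewrite mulr_ge0// exprn_ge0.
      have := expect_sumsq; rewrite hh -exprM => /(ler_wpM2l _) esq.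
      apply: le_trans (esq _ _) _; first by rewrite mulr_ge0// exprn_ge0.
      by rewrite -mulrA; lra.
    have -> : b ^+ 2 * (n * n.-1 * n.-2)%:R - 1 = - (h ^+ 2 - 1)^-1.
      have n1E : n.-1%:R = h ^+ 2 - 1 :> R by rewrite -hh -subn1 natrB// ltnW.
      have n2E : n.-2%:R = h ^+ 2 - 2 :> R by rewrite -hh -subn2 natrB.
      rewrite !natrM n1E n2E bE hh; field.
      by rewrite !gt_eqF//; lra.
    rewrite mulrN normrN normrM (normrM 4) (ger0_norm (ler0n _ 4)).
    rewrite [X in _ * X]ger0_norm; last by rewrite invr_ge0; lra.
    rewrite [leRHS](_ : _ = 4 * `|nu| * (2 / h)); last by ring.
    apply: ler_wpM2l; first by rewrite mulr_ge0.
    rewrite -[leLHS]mul1r ler_pdivrMr; last by lra.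
    by rewrite mulrAC ler_pdivlMr//; nra.
  apply: (@le_trans _ _ (expect q (fun w =>
      4 * b ^+ 2 * `|sumsq w - expect q sumsq| +
      ((16 + 8 * `|nu|) / h + 8 / h)))).
    apply: le_expect => // w.
    have -> : T w - 4 * nu = 4 * b ^+ 2 * (sumsq w - expect q sumsq) +
        ((4 * b ^+ 2 * expect q sumsq - 4 * nu) -
         2 * b ^+ 2 * \sum_i \sum_j X i j w ^+ 2) by rewrite /T; ring.
    apply: le_trans (ler_normD _ _) _; apply: lerD.
      by rewrite normrM ger0_norm// mulr_ge0// exprn_ge0.
    apply: le_trans (ler_normB _ _) _; apply: lerD => //.
    rewrite normrM ger0_norm; last by rewrite mulr_ge0// exprn_ge0.
    apply: le_trans (ler_wpM2l _ (sumX2 w)) _; first by rewrite mulr_ge0// exprn_ge0.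
    by rewrite -mulrA; lra.
  rewrite expectD expectZ (expect_cst qP).
  have /(ler_wpM2l _) dev := sumsq_dev.
  have b20 : 0 <= 4 * b ^+ 2 by rewrite mulr_ge0// exprn_ge0.
  have := dev _ b20; rewrite (_ : 4 * b ^+ 2 * (5 * h ^+ 5) =
    20 * (b ^+ 2 * h ^+ 5)); last by ring.
  move: b5; set y := b ^+ 2 * h ^+ 5; set z := 4 * b ^+ 2 * _; lra.
have -> : expect q (fun w => scaled_total w * f (scaled_total w)) -
    4 * nu * expect q (fun w => f' (scaled_total w)) =
   (expect q (fun w => scaled_total w * f (scaled_total w)) -
    expect q (fun w => f' (scaled_total w) * T w)) +
   expect q (fun w => f' (scaled_total w) * (T w - 4 * nu)).
  rewrite (_ : expect q (fun w => f' (scaled_total w) * (T w - 4 * nu)) =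
    expect q (fun w => f' (scaled_total w) * T w) -
    4 * nu * expect q (fun w => f' (scaled_total w))).
    by ring.
  by rewrite -expectZ -expectB; apply: eq_expect => w; ring.
rewrite [leRHS]mulrDl; apply: le_trans (ler_normD _ _) _; apply: lerD.
  exact: le_trans (stein_expansion C20 ff') rem_le.
apply: (@le_trans _ _ (expect q (fun w => C1 * `|T w - 4 * nu|))).
  by apply: norm_expect_le => // w; rewrite normrM ler_wpM2r.
rewrite expectZ mulrAC [leRHS]mulrC; exact: ler_wpM2l.
Qed.

End DissociatedArray.

(** * The Stein equation of the normal law *)

Local Open Scope classical_set_scope.

Section MeanValue.
Context (R : realType) (f f' : R -> R).
Hypothesis f_derive : forall x : R, is_derive x 1 f (f' x).

Lemma derive_continuous : continuous f.
Proof.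
move=> x; apply: differentiable_continuous; apply/derivable1_diffP.
exact: ex_derive.
Qed.

Lemma mean_value x y :
  exists2 c, `|c - x| <= `|y - x| & f y - f x = f' c * (y - x).
Proof.
have cf a b : {within `[a, b], continuous f}.
  by apply: continuous_subspaceT; exact: derive_continuous.
have [xy|/ltW yx] := leP x y.
  have [c] := MVT_segment xy (fun z _ => f_derive z) (cf _ _).
  rewrite in_itv/= => /andP[xc cy] ->; exists c => //.
  by rewrite !ger0_norm ?subr_ge0// lerD2r.
have [c] := MVT_segment yx (fun z _ => f_derive z) (cf _ _).
rewrite in_itv/= => /andP[yc cx] E; exists c.
  by rewrite !ler0_norm ?subr_le0// lerN2 lerD2r.
by rewrite -[LHS]opprB E; ring.
Qed.

Lemma bounded_derive_lipschitz C : (forall x, `|f' x| <= C) ->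
  forall x y, `|f x - f y| <= C * `|x - y|.
Proof.
move=> f'C x y; have [c _ ->] := mean_value y x.
by rewrite normrM ler_wpM2r.
Qed.

Lemma lipschitz_derive_taylor C :
  (forall x y, `|f' x - f' y| <= C * `|x - y|) ->
  forall x y, `|f y - f x - f' x * (y - x)| <= C * (y - x) ^+ 2.
Proof.
move=> f'C x y; have C0 : 0 <= C.
  by have := f'C 1 0; rewrite subr0 normr1 mulr1; apply: le_trans.
have [c cx ->] := mean_value x y.
rewrite -mulrBl normrM -real_normK ?num_real// expr2 mulrA.
apply: ler_wpM2r => //; apply: le_trans (f'C _ _) _.
exact: ler_wpM2l.
Qed.

End MeanValue.

Lemma lipschitz_continuous (R : realType) (g : R -> R) L :
  (forall x y, `|g x - g y| <= L * `|x - y|) -> continuous g.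
Proof.
move=> gL x; apply/cvgrPdist_lt => e e0.
have L0 : 0 <= L.
  by have := gL 1 0; rewrite subr0 normr1 mulr1; apply: le_trans.
near=> y.
apply: le_lt_trans (gL _ _) _.
apply: (@le_lt_trans _ _ ((L + 1) * `|x - y|)).
  by rewrite ler_wpM2r// lerDl.
rewrite mulrC -ltr_pdivlMr ?ltr_wpDl//.
near: y; apply: (@cvgr_dist_lt _ _ _ (nbhs x) _ id) => //.
by rewrite divr_gt0// ltr_wpDl.
Unshelve. all: by end_near. Qed.

Lemma lipschitz_compact_le (R : realType) (g : R -> R) (K L : R) : 0 <= K ->
  (forall x y, `|g x - g y| <= L * `|x - y|) ->
  (forall x, K <= `|x| -> g x = 0) ->
  forall x, `|g x| <= 2 * K * L.
Proof.
move=> K0 gL gK x.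
have L0 : 0 <= L by have := gL 1 0; rewrite subr0 normr1 mulr1; apply: le_trans.
have [/gK ->|xK] := leP K `|x|; first by rewrite normr0 !mulr_ge0.
have gK0 : g K = 0 by rewrite gK// ger0_norm.
rewrite -[g x]subr0 -{1}gK0.
apply: le_trans (gL x K) _; rewrite mulrC ler_wpM2r//.
by apply: le_trans (ler_normB _ _) _; rewrite (ger0_norm K0); lra.
Qed.

Lemma lipschitz_compact_bounded (R : realType) (g : R -> R) (K L : R) :
  (forall x y, `|g x - g y| <= L * `|x - y|) ->
  (forall x, K <= `|x| -> g x = 0) ->
  exists G : R, forall x, `|g x| <= G.
Proof.
move=> gL gK; exists (2 * `|K| * L); apply: lipschitz_compact_le => // x Kx.
by apply: gK; exact: le_trans (ler_norm K) Kx.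
Qed.

Section NormalMean.
Context (R : realType) (s : R).
Hypothesis s0 : 0 < s.
Local Notation mu := (@lebesgue_measure R).

Definition normal_mean (g : R -> R) : R :=
  \int[mu]_x (g x * normal_pdf 0 s x).

Lemma normal_mean_integrable (g : R -> R) M : continuous g ->
  (forall x, `|g x| <= M) ->
  mu.-integrable [set: R] (EFin \o (fun x => g x * normal_pdf 0 s x)).
Proof.
move=> cg gM.
apply: (@eq_integrable _ _ _ mu _ measurableT
  ((EFin \o g) \* (EFin \o normal_pdf 0 s))%E) => //.
apply: integrableMr => //.
- exact: continuous_measurable_fun.
- exists M; split; first exact: num_real.
  by move=> y My x _; exact: le_trans (gM x) (ltW My).
- exact: integrable_normal_pdf.
Qed.

Lemma is_derive_itvNy (u : R -> R) : continuous u ->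
  mu.-integrable [set: R] (EFin \o u) ->
  forall x : R, is_derive x 1 (fun z => \int[mu]_(t in `]-oo, z]) u t) (u x).
Proof.
move=> cu iu x.
have [|||dF <-] := @continuous_FTC1 _ u -oo%O x (x + 1) _ _ _ (cu x).
- by rewrite ltrDl.
- by apply: integrableS iu => //; exact: measurable_itv.
- by rewrite ltNyr.
by rewrite derive1E; exact: DeriveDef.
Qed.

(** The integrating factor of the equation is the normal density [phi], so
    [f = H / (s ^ 2 * phi)] with [H] the antiderivative of [g * phi] that
    vanishes at [-oo]. Because [g] has mean zero, [H] vanishes on both sides of
    the support of [g]. Hence [f] has compact support too, and its bounds follow
    from continuity on a segment instead of estimates of the normal tail. *)
Lemma stein_equation (g : R -> R) (K L : R) :
  (forall x y, `|g x - g y| <= L * `|x - y|) ->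
  (forall x, K <= `|x| -> g x = 0) ->
  normal_mean g = 0 ->
  exists f f' : R -> R, exists C1 C2 : R,
  [/\ forall x, s ^+ 2 * f' x - x * f x = g x,
      forall x, `|f' x| <= C1, 0 <= C2 &
      forall x y, `|f y - f x - f' x * (y - x)| <= C2 * (y - x) ^+ 2].
Proof.
move=> gL gK g0.
wlog K0 : K gK / 0 <= K.
  by move=> /(_ `|K|); apply => // x Kx; apply: gK; exact: le_trans (ler_norm K) Kx.
have sN0 : s != 0 by rewrite gt_eqF.
have L0 : 0 <= L by have := gL 1 0; rewrite subr0 normr1 mulr1; apply: le_trans.
have gM := lipschitz_compact_le K0 gL gK.
have cg : continuous g by exact: lipschitz_continuous gL.
pose u x := g x * normal_pdf 0 s x.
have cu : continuous u.
  by move=> x; apply: cvgM; [exact: cg|exact: continuous_normal_pdf].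
have iu : mu.-integrable [set: R] (EFin \o u) by exact: normal_mean_integrable gM.
pose H z := \int[mu]_(t in `]-oo, z]) u t.
have dH (x : R) : is_derive x 1 H (u x) by exact: is_derive_itvNy.
have u0 x : K <= `|x| -> u x = 0 by move=> Kx; rewrite /u gK// mul0r.
have H0 x : K <= `|x| -> H x = 0.
  move=> Kx; have [x0|x0] := leP 0 x.
    have Hx : normal_mean g - H x = \int[mu]_(t in `]x, +oo[) u t.
      by rewrite -(@Rintegral_itvB _ u -oo%O +oo%O x) ?set_itvNyy// bnd_simp.
    apply/eqP; rewrite -oppr_eq0 -(add0r (- _)) -g0 Hx; apply/eqP.
    rewrite (@eq_Rintegral _ _ _ mu _ (cst 0)) ?Rintegral_cst ?mul0r// => t.
    rewrite inE/= in_itv/= andbT => xt; apply: u0.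
    apply: le_trans Kx _; rewrite !ger0_norm// ?(ltW xt)//.
    exact: le_trans x0 (ltW xt).
  rewrite /H (@eq_Rintegral _ _ _ mu _ (cst 0)) ?Rintegral_cst ?mul0r// => t.
  rewrite inE/= in_itv/= => tx; apply: u0.
  apply: le_trans Kx _; rewrite !ltr0_norm ?lerN2//.
  exact: le_lt_trans tx x0.
pose e x := expR (x ^+ 2 / (2 * s ^+ 2)).
have de (x : R) : is_derive x 1 e (x / s ^+ 2 * e x).
  by apply: is_derive_eq; rewrite /GRing.scale/= /e; field.
pose c := (s ^+ 2 * normal_peak s)^-1.
pose f x := c * (H x * e x).
pose f' x := (g x + x * f x) / s ^+ 2.
have ue x : u x * e x = g x * normal_peak s.
  rewrite /u /e normal_pdfE//= /normal_fun subr0 -!mulrA -expRD.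
  rewrite (_ : _ + _ = 0) ?expR0 ?mulr1//.
  by rewrite -mulr_natl; field.
have c1 : c * normal_peak s = (s ^+ 2)^-1.
  by rewrite /c invfM mulfVK// gt_eqF// normal_peak_gt0.
have df (x : R) : is_derive x 1 f (f' x).
  apply: is_derive_eq; rewrite /GRing.scale/= (mulrC (e x)) ue /f' /f.
  by rewrite mulrDl -c1; ring.
have f0 x : K <= `|x| -> f x = 0 by move=> Kx; rewrite /f H0// mul0r mulr0.
have [M fM] : exists M, forall x, `|f x| <= M.
  have [||c0 _ cM] := @EVT_max R (fun x => `|f x|) (- K) K.
  - by rewrite ge0_cp.
  - apply: continuous_subspaceT => x; apply: continuous_comp.
      exact: derive_continuous df x.
    exact: norm_continuous.
  exists `|f c0| => x; have [/f0 ->|xK] := leP K `|x|; first by rewrite normr0.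
  by apply: cM; rewrite in_itv/= -ler_norml ltW.
have M0 : 0 <= M by exact: le_trans (fM 0).
have xfM x : `|x * f x| <= K * M.
  have [/f0 ->|/ltW xK] := leP K `|x|; first by rewrite mulr0 normr0 mulr_ge0.
  by rewrite normrM ler_pM.
pose C1 := (2 * K * L + K * M) / s ^+ 2.
have f'C1 x : `|f' x| <= C1.
  rewrite normrM [X in _ * X]ger0_norm ?invr_ge0 ?sqr_ge0//.
  rewrite ler_wpM2r ?invr_ge0 ?sqr_ge0//.
  by apply: le_trans (ler_normD _ _) _; apply: lerD.
have C10 : 0 <= C1 by exact: le_trans (f'C1 0).
have f'0 x : K <= `|x| -> f' x = 0.
  by move=> Kx; rewrite /f' gK// f0// mulr0 addr0 mul0r.
(* [f'] is an affine combination of [g] and [x * f x], so it is enough to bound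
   the derivative of the latter *)
have xf_lip x y : `|x * f x - y * f y| <= (M + K * C1) * `|x - y|.
  apply: (@bounded_derive_lipschitz R (fun x => x * f x) (fun x => f x + x * f' x)).
    move=> z; apply: is_derive_eq.
    by rewrite -[_%R *: _ in LHS]/(_ * _) /= addrC [_ *: _]mulr1.
  move=> z; apply: le_trans (ler_normD _ _) _; apply: lerD => //.
  have [/f'0 ->|/ltW zK] := leP K `|z|; first by rewrite mulr0 normr0 mulr_ge0.
  by rewrite normrM ler_pM.
exists f, f', C1, ((L + (M + K * C1)) / s ^+ 2); split => //.
- by move=> x; rewrite /f'; field.
- by rewrite divr_ge0 ?sqr_ge0// !addr_ge0// mulr_ge0.
- apply: lipschitz_derive_taylor => // x y.
  rewrite /f' -mulrBl normrM [X in _ * X]ger0_norm ?invr_ge0 ?sqr_ge0//.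
  rewrite mulrAC ler_wpM2r ?invr_ge0 ?sqr_ge0//.
  rewrite (_ : _ - _ = (g x - g y) + (x * f x - y * f y)); last by ring.
  by rewrite mulrDl; apply: le_trans (ler_normD _ _) _; apply: lerD.
Qed.

End NormalMean.

(** * From the Stein identity to convergence in law *)

Section Trapezoid.
Context (R : realType) (a b d : R).
Hypothesis d0 : 0 < d.

(** Lipschitz substitute for the indicator of the segment [[a, b]], with sides of
    width [d]. *)
Definition trapezoid (y : R) : R :=
  Num.max 0 (Num.min 1 (Num.min (1 + (y - a) / d) (1 + (b - y) / d))).

Lemma trapezoid_ge0 y : 0 <= trapezoid y.
Proof. by rewrite /trapezoid le_max lexx. Qed.

Lemma trapezoid_le1 y : trapezoid y <= 1.
Proof. by rewrite /trapezoid ge_max ler01 ge_min lexx. Qed.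

Lemma norm_trapezoid y : `|trapezoid y| <= 1.
Proof. by rewrite ger0_norm ?trapezoid_ge0 ?trapezoid_le1. Qed.

Lemma trapezoid1 y : a <= y <= b -> trapezoid y = 1.
Proof.
move=> /andP[ay yb]; apply/eqP; rewrite eq_le trapezoid_le1/= /trapezoid.
by rewrite le_max !le_min lexx !lerDl !divr_ge0 ?subr_ge0 ?orbT// ltW.
Qed.

Lemma trapezoid0 y : (y <= a - d) || (b + d <= y) -> trapezoid y = 0.
Proof.
move=> yab; apply/eqP; rewrite eq_le trapezoid_ge0 andbT /trapezoid.
rewrite ge_max lexx !ge_min; apply/orP; right.
by case/orP: yab => ?; apply/orP; [left|right];
  rewrite -lerBrDl sub0r ler_pdivrMr// mulN1r; lra.
Qed.

Lemma trapezoid_lipschitz x y :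
  `|trapezoid x - trapezoid y| <= d^-1 * `|x - y|.
Proof.
have half z t : trapezoid z <= trapezoid t + d^-1 * `|z - t|.
  have c0 : 0 <= d^-1 * `|z - t| by rewrite mulr_ge0// invr_ge0 ltW.
  have e1 : (z - a) / d <= (t - a) / d + d^-1 * `|z - t|.
    rewrite (mulrC d^-1) -mulrDl ler_pM2r ?invr_gt0//.
    by have := ler_norm (z - t); lra.
  have e2 : (b - z) / d <= (b - t) / d + d^-1 * `|z - t|.
    rewrite (mulrC d^-1) -mulrDl ler_pM2r ?invr_gt0//.
    by have := ler_norm (t - z); rewrite (distrC t); lra.
  move: e1 e2 c0; rewrite /trapezoid.
  set p := (z - a) / d; set q := (b - z) / d; set p' := (t - a) / d.
  set q' := (b - t) / d; set c := d^-1 * _ => e1 e2 c0.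
  have minD (u v u' v' : R) : u <= u' + c -> v <= v' + c ->
      Num.min u v <= Num.min u' v' + c.
    move=> uu' vv'; rewrite -lerBlDr le_min !lerBlDr !ge_min uu' vv'.
    by rewrite orbT.
  rewrite ge_max addr_ge0 ?le_max ?lexx//= -lerBlDr le_max.
  by apply/orP; right; rewrite lerBlDr !minD ?lerDl -?addrA ?lerD2l.
have := half x y; have := half y x; rewrite (distrC y) => yx xy.
by rewrite ler_norml; apply/andP; split; lra.
Qed.

Lemma trapezoid_continuous : continuous trapezoid.
Proof. exact: lipschitz_continuous trapezoid_lipschitz. Qed.

End Trapezoid.

Section NormalMeanTheory.
Context (R : realType) (s : R).
Local Notation mu := (@lebesgue_measure R).
Local Notation N := (normal_prob 0 s).

Let pdf_integrable A : measurable A ->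
  mu.-integrable A (EFin \o normal_pdf 0 s).
Proof. by move=> mA; apply: integrableS (integrable_normal_pdf 0 s). Qed.

Let pdf_restrict A : measurable A ->
  fine (N A) = \int[mu]_x ((normal_pdf 0 s \_ A) x).
Proof. by move=> mA; rewrite -Rintegral_mkcond. Qed.

Let pdf_restrict_integrable (A : set (measurableTypeR R)) : measurable A ->
  mu.-integrable setT (EFin \o (normal_pdf 0 s \_ A)).
Proof.
move=> mA; rewrite -restrict_EFin.
exact: (iffLR (integrable_mkcond _ mA) (pdf_integrable mA)).
Qed.

Variables (g : R -> R) (M : R).
Hypothesis cg : continuous g.
Hypothesis gM : forall x, `|g x| <= M.

Lemma normal_mean_le A : measurable A -> (forall x, g x <= \1_A x) ->
  normal_mean s g <= fine (N A).
Proof.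
move=> mA gA; rewrite pdf_restrict//; apply: le_Rintegral => //.
- exact: normal_mean_integrable gM.
- exact: pdf_restrict_integrable.
- move=> x _; apply: le_trans (ler_wpM2r _ (gA x)) _; first exact: normal_pdf_ge0.
  by rewrite patchE indicE; case: ifP => _; rewrite ?mul1r ?mul0r.
Qed.

Lemma normal_mean_ge A : measurable A -> (forall x, \1_A x <= g x) ->
  fine (N A) <= normal_mean s g.
Proof.
move=> mA gA; rewrite pdf_restrict//; apply: le_Rintegral => //.
- exact: pdf_restrict_integrable.
- exact: normal_mean_integrable gM.
- move=> x _; apply: (le_trans _ (ler_wpM2r _ (gA x))); last exact: normal_pdf_ge0.
  by rewrite patchE indicE; case: ifP => _; rewrite ?mul1r ?mul0r.
Qed.

Lemma normal_meanBZ (k : R -> R) (M' c : R) : continuous k -> (forall x, `|k x| <= M') ->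
  normal_mean s (fun x => g x - c * k x) = normal_mean s g - c * normal_mean s k.
Proof.
move=> ck kM; have ig := normal_mean_integrable s cg gM.
have ik := normal_mean_integrable s ck kM.
rewrite /normal_mean -RintegralZl// -RintegralB//; last first.
  by apply: eq_integrable (integrableZl measurableT c ik).
by apply: eq_Rintegral => x _; rewrite mulrBl mulrA.
Qed.

End NormalMeanTheory.

(** Continuity of the normal law along an increasing sequence of segments. *)
Lemma normal_prob_segment_cvg1 (R : realType) (s eta : R) : 0 < eta ->
  exists M0 : R, forall M, M0 <= M -> 1 - eta <= fine (normal_prob 0 s `[- M, M]).
Proof.
move=> eta0; pose F n : set R := `[- n%:R, n%:R].
have mF n : measurable (F n) by exact: measurable_itv.
have UF : \bigcup_n F n = setT.
  apply/seteqP; split => // x _; exists (Num.truncn `|x|).+1 => //.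
  by rewrite /F/= in_itv/= -ler_norml ltW// truncnS_gt.
have ndF : nondecreasing_seq F.
  move=> m n mn; apply/subsetPset => x; rewrite /F/= !in_itv/= -!ler_norml.
  by move=> /le_trans; apply; rewrite ler_nat.
have : normal_prob 0 s (F n) @[n --> \oo] --> 1%:E.
  rewrite -[X in _ --> X](@probability_setT _ _ _ (normal_prob 0 s)) -UF.
  by apply: nondecreasing_cvg_mu => //; rewrite UF.
move=> /fine_cvgP[_]/cvgrPdist_le.
move=> /(_ _ eta0)[n _ /(_ n.+1 (leqnSn n))/= nF].
exists n.+1%:R => M nM.
have : fine (normal_prob 0 s (F n.+1)) <= fine (normal_prob 0 s `[- M, M]).
  apply: fine_le; try by apply: fin_num_measure; exact: measurable_itv.
  apply: le_measure; rewrite ?inE//; try exact: measurable_itv.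
  move=> x; rewrite /F/= !in_itv/= -!ler_norml => /le_trans; exact.
by have := le_trans (ler_norm _) nF; lra.
Qed.

Section SteinCriterion.
Context (R : realType) (s : R) (Om : nat -> finType).
Variables (q : forall n, Om n -> R) (W : forall n, Om n -> R).
Hypothesis s0 : 0 < s.
Hypothesis qP : forall n, is_distribution (@q n).
Hypothesis stein_cvg : forall (f f' : R -> R) (C1 C2 : R),
  (forall x, `|f' x| <= C1) -> 0 <= C2 ->
  (forall x y, `|f y - f x - f' x * (y - x)| <= C2 * (y - x) ^+ 2) ->
  expect (@q n) (fun w => W w * f (W w)) -
    s ^+ 2 * expect (@q n) (fun w => f' (W w)) @[n --> \oo] --> (0 : R).

Let B := s ^+ 2 + 1.

(** The case [f = id] of the Stein identity shows that the second moments tend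
    to [s ^ 2]. *)
Lemma second_moment_near :
  \forall n \near \oo, expect (@q n) (fun w => W w ^+ 2) <= B.
Proof.
have id_lip (x : R) : `|(fun=> 1 : R) x| <= 1 by rewrite normr1.
have id_taylor (x y : R) :
    `|id y - id x - (fun=> 1 : R) x * (y - x)| <= 0 * (y - x) ^+ 2.
  by rewrite mul1r subrr normr0 mul0r.
have id_cvg := stein_cvg id_lip (lexx 0) id_taylor.
move/cvgrPdist_le : id_cvg => /(_ _ ltr01); apply: filterS => n.
rewrite sub0r normrN expect_cst// mulr1 => /(le_trans (ler_norm _)).
by rewrite lerBlDl.
Qed.

Lemma lipschitz_centered_cvg (g : R -> R) (K L : R) :
  (forall x y, `|g x - g y| <= L * `|x - y|) ->
  (forall x, K <= `|x| -> g x = 0) -> normal_mean s g = 0 ->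
  expect (@q n) (fun w => g (W w)) @[n --> \oo] --> (0 : R).
Proof.
move=> gL gK g0.
have [f [f' [C1 [C2 [fE f'C C20 ff']]]]] := stein_equation s0 gL gK g0.
rewrite -oppr0; under eq_fun => n.
  rewrite (_ : expect _ _ = - (expect (@q n) (fun w => W w * f (W w)) -
    s ^+ 2 * expect (@q n) (fun w => f' (W w)))); last first.
    rewrite opprB -expectZ -expectB; apply: eq_expect => w.
    by rewrite -fE.
  over.
by apply: cvgN; exact: stein_cvg ff'.
Qed.

Let B_ge1 : 1 <= B.
Proof. by rewrite /B lerDr sqr_ge0. Qed.

(** Chebyshev's inequality, pointwise: the second moment pays for the points
    outside [[- M, M]]. *)
Let far_le (e M w : R) : 0 < e -> B / e <= M -> 1 <= M -> M <= `|w| ->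
  1 <= e / B * w ^+ 2.
Proof.
move=> e0 BeM M1 Mw; have B0 : 0 < B by exact: lt_le_trans B_ge1.
rewrite mulrAC ler_pdivlMr// mul1r mulrC -ler_pdivrMr//.
apply: le_trans BeM _; rewrite -real_normK ?num_real//.
by apply: le_trans (Mw) _; rewrite expr2 ler_peMr// (le_trans M1).
Qed.

(** Subtracting from [g] the multiple of a wide trapezoid [k] with the same normal
    mean reduces to the centred case. The expectation of [k] is close to 1 for
    the normal law and, by Chebyshev's inequality, for [W] as well. *)
Lemma lipschitz_compact_cvg (g : R -> R) (K L : R) :
  (forall x y, `|g x - g y| <= L * `|x - y|) ->
  (forall x, K <= `|x| -> g x = 0) ->
  expect (@q n) (fun w => g (W w)) @[n --> \oo] --> normal_mean s g.
Proof.
move=> gL gK; set m := normal_mean s g; apply/cvgrPdist_le => e e0.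
(* the first bound keeps the mean of [k] away from 0, the second one absorbs the
   factor [m / kap] *)
pose eta := Num.min (2^-1) (e / (4 * (`|m| + 1))).
have m1 : 0 < `|m| + 1 by rewrite ltr_wpDl.
have eta0 : 0 < eta by rewrite lt_min invr_gt0 ltr0n/= divr_gt0// mulr_gt0.
have eta1 : eta <= 2^-1 by rewrite ge_min lexx.
have eta2 : 2 * `|m| * eta <= e / 2.
  have : eta <= e / (4 * (`|m| + 1)) by rewrite ge_min lexx orbT.
  move=> eta_le; apply: le_trans (ler_wpM2l _ eta_le) _; first by rewrite mulr_ge0.
  rewrite mulrA ler_pdivrMr ?mulr_gt0//; have := normr_ge0 m; nra.
have [M0 MP] := normal_prob_segment_cvg1 s eta0.
pose M := Num.max M0 (Num.max 1 (B / eta)).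
have M0M : M0 <= M by rewrite le_max lexx.
have M1 : 1 <= M by rewrite !le_max lexx !orbT.
have BM : B / eta <= M by rewrite !le_max lexx !orbT.
pose k := trapezoid (- M) M 1.
have ck : continuous k by exact: trapezoid_continuous.
have kap1 : normal_mean s k <= 1.
  have := @normal_mean_le _ s k 1 ck (norm_trapezoid _ _ _) setT measurableT.
  rewrite probability_setT; apply => x.
  by rewrite indicT trapezoid_le1.
have kap0 : 1 - eta <= normal_mean s k.
  apply: le_trans (MP _ M0M) _; apply: (@normal_mean_ge _ s k 1 ck (norm_trapezoid _ _ _)).
    exact: measurable_itv.
  move=> x; rewrite indicE; have [|_] := boolP (x \in _); last exact: trapezoid_ge0.
  by rewrite inE/= in_itv/= => xM; rewrite /k trapezoid1.
set kap := normal_mean s k in kap1 kap0.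
have kap_gt0 : 2^-1 <= kap by lra.
have cg : continuous g by exact: lipschitz_continuous gL.
have [G gG] := lipschitz_compact_bounded gL gK.
have centered : normal_mean s (fun x => g x - m / kap * k x) = 0.
  rewrite (normal_meanBZ s cg gG _ ck (norm_trapezoid _ _ _)) -/m -/kap.
  by rewrite divfK ?subrr//; lra.
have lip : forall x y, `|(g x - m / kap * k x) - (g y - m / kap * k y)| <=
    (L + `|m / kap|) * `|x - y|.
  move=> x y; rewrite (_ : _ - _ = (g x - g y) - m / kap * (k x - k y)); last by ring.
  apply: le_trans (ler_normB _ _) _; rewrite mulrDl; apply: lerD => //.
  rewrite normrM ler_wpM2l//; have := trapezoid_lipschitz (- M) M ltr01 x y.
  by rewrite invr1 mul1r.
have supp x : Num.max K (M + 1) <= `|x| -> g x - m / kap * k x = 0.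
  rewrite ge_max => /andP[/gK -> Mx]; rewrite /k trapezoid0 ?mulr0 ?subrr//.
  by apply/orP; move: Mx; case: (ger0P x) => _ ?; [right|left]; lra.
have /cvgrPdist_le/(_ (e / 2)) := lipschitz_centered_cvg lip supp centered.
rewrite divr_gt0// => /(_ isT) centered_near.
near=> n.
have Ek1 : expect (@q n) (fun w => k (W w)) <= 1.
  rewrite -[leRHS](expect_cst (qP n)); apply: le_expect => // w.
  exact: trapezoid_le1.
have Ek0 : 1 - eta <= expect (@q n) (fun w => k (W w)).
  apply: (@le_trans _ _ (expect (@q n) (fun w => 1 - eta / B * W w ^+ 2))).
    rewrite expectB (expect_cst (qP n)) expectZ lerD2l lerN2.
    have W2 : expect (@q n) (fun w => W w ^+ 2) <= B.
      by near: n; exact: second_moment_near.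
    rewrite mulrAC ler_pdivrMr ?(lt_le_trans _ B_ge1)// ler_wpM2l// ltW//.
  apply: le_expect => // w.
  have [Mw|Mw] := leP M `|W w|.
    have := trapezoid_ge0 (- M) M 1 (W w); rewrite -/k.
    by have := far_le eta0 BM M1 Mw; lra.
  rewrite /k trapezoid1//; last by rewrite -ler_norml ltW.
  rewrite lerBlDr lerDl mulr_ge0 ?sqr_ge0//.
  by rewrite divr_ge0 ?(ltW eta0)// (le_trans _ B_ge1).
have : `|0 - expect (@q n) (fun w => g (W w) - m / kap * k (W w))| <= e / 2.
  by near: n.
rewrite sub0r normrN expectB expectZ.
set Eg := expect _ (fun w => g _).
set Ek := expect _ (fun w => k _) in Ek0 Ek1 * => Eg_le.
rewrite distrC (_ : Eg - m = (Eg - m / kap * Ek) + m / kap * (Ek - kap)); last first.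
  by field; lra.
apply: le_trans (ler_normD _ _) _; rewrite (splitr e); apply: lerD => //.
apply: le_trans eta2; rewrite normrM; apply: ler_pM => //.
  rewrite normrM normfV (ger0_norm (_ : 0 <= kap)); last by lra.
  rewrite ler_pdivrMr; last by lra.
  rewrite mulrAC -[leLHS]mul1r; apply: ler_wpM2r => //; lra.
by rewrite ler_norml; apply/andP; split; lra.
Unshelve. all: by end_near. Qed.

Let trapezoid_cvg (a b d : R) : 0 < d ->
  expect (@q n) (fun w => trapezoid a b d (W w)) @[n --> \oo] -->
    normal_mean s (trapezoid a b d).
Proof.
move=> d0; apply: (@lipschitz_compact_cvg _ (`|a| + `|b| + d) d^-1).
  exact: trapezoid_lipschitz.
move=> x abx; apply: trapezoid0 => //; apply/orP.
have := ler_norm b; have := ler_norm (- a); rewrite normrN.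
have := normr_ge0 a; have := normr_ge0 b.
by move: abx; case: (ger0P x) => _ ? ? ? ? ?; [right|left]; lra.
Qed.

Local Notation Phi y := (fine (normal_prob 0 s `]-oo, y])).

(** A point below [x] either lies in [[- M, x]], where the trapezoid is 1, or is
    far from the origin and is paid for by the second moment. *)
Let cdf_upper x d e : 0 < d -> 0 < e ->
  \forall n \near \oo,
    expect (@q n) (fun w => (W w <= x)%R%:R) <= Phi (x + d) + e.
Proof.
move=> d0 e0; have e20 : 0 < e / 2 by rewrite divr_gt0.
pose M := Num.max 1 (B / (e / 2)).
have M1 : 1 <= M by rewrite le_max lexx.
have BM : B / (e / 2) <= M by rewrite le_max lexx orbT.
pose g := trapezoid (- M) x d.
have g_le : normal_mean s g <= Phi (x + d).
  apply: (@normal_mean_le _ s g 1 (trapezoid_continuous d0) (norm_trapezoid _ _ _)).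
    exact: measurable_itv.
  move=> y; rewrite indicE; have [_|] := boolP (y \in _); first exact: trapezoid_le1.
  rewrite notin_setE/= in_itv/= => /negP; rewrite -ltNge => xy.
  by rewrite /g trapezoid0// (ltW xy) orbT.
have /cvgrPdist_le/(_ _ e20) := trapezoid_cvg (a := - M) (b := x) d0.
move=> g_near; near=> n.
apply: (@le_trans _ _ (expect (@q n) (fun w => g (W w) + e / 2 / B * W w ^+ 2))).
  apply: le_expect => // w; have g0 := trapezoid_ge0 (- M) x d (W w).
  have [Mw|Mw] := leP M `|W w|.
    apply: (@le_trans _ _ 1); first by rewrite lern1 leq_b1.
    by have := far_le e20 BM M1 Mw; rewrite -/g in g0; lra.
  have W0 : 0 <= e / 2 / B * W w ^+ 2.
    by rewrite mulr_ge0 ?sqr_ge0// divr_ge0 ?(ltW e20)// (le_trans _ B_ge1).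
  have [wx|_] := leP (W w) x; last by rewrite addr_ge0.
  rewrite /g trapezoid1 ?lerDl//.
  by move: Mw; rewrite wx andbT ltr_norml => /andP[/ltW].
rewrite expectD expectZ.
have W2 : expect (@q n) (fun w => W w ^+ 2) <= B.
  by near: n; exact: second_moment_near.
have W2e : e / 2 / B * expect (@q n) (fun w => W w ^+ 2) <= e / 2.
  by rewrite mulrAC ler_pdivrMr ?(lt_le_trans _ B_ge1)// ler_wpM2l// ltW.
have : `|normal_mean s g - expect (@q n) (fun w => g (W w))| <= e / 2.
  by near: n.
by rewrite ler_norml => /andP[+ _]; lra.
Unshelve. all: by end_near. Qed.

(** The same argument for the points above [x] bounds the complementary event. *)
Let cdf_lower x d e : 0 < d -> 0 < e ->
  \forall n \near \oo,
    Phi (x - d) - e <= expect (@q n) (fun w => (W w <= x)%R%:R).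
Proof.
move=> d0 e0; have e20 : 0 < e / 2 by rewrite divr_gt0.
pose M := Num.max 1 (B / (e / 2)).
have M1 : 1 <= M by rewrite le_max lexx.
have BM : B / (e / 2) <= M by rewrite le_max lexx orbT.
pose g := trapezoid x M d.
have g_le : normal_mean s g <= 1 - Phi (x - d).
  have -> : 1 - Phi (x - d) = fine (normal_prob 0 s `]x - d, +oo[).
    have mI : measurable (`]-oo, x - d] : set (measurableTypeR R)).
      exact: measurable_itv.
    rewrite -setCitvl; have := probability_setC (normal_prob 0 s) mI.
    by move=> ->; rewrite [RHS]fineB// fin_num_measure.
  apply: (@normal_mean_le _ s g 1 (trapezoid_continuous d0) (norm_trapezoid _ _ _)).
    exact: measurable_itv.
  move=> y; rewrite indicE; have [_|] := boolP (y \in _); first exact: trapezoid_le1.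
  rewrite notin_setE/= in_itv/= andbT => /negP; rewrite -leNgt => xy.
  by rewrite /g trapezoid0// xy.
have /cvgrPdist_le/(_ _ e20) := trapezoid_cvg (a := x) (b := M) d0.
move=> g_near; near=> n.
apply: (@le_trans _ _ (expect (@q n)
    (fun w => 1 - (g (W w) + e / 2 / B * W w ^+ 2)))); last first.
  apply: le_expect => // w; have g0 := trapezoid_ge0 x M d (W w).
  have W0 : 0 <= e / 2 / B * W w ^+ 2.
    by rewrite mulr_ge0 ?sqr_ge0// divr_ge0 ?(ltW e20)// (le_trans _ B_ge1).
  have [Mw|Mw] := leP M `|W w|.
    apply: (@le_trans _ _ 0); last exact: ler0n.
    by have := far_le e20 BM M1 Mw; rewrite -/g in g0; lra.
  have [wx|wx] /= := leP (W w) x; first by rewrite -/g in g0; lra.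
  rewrite /g trapezoid1//; first by lra.
  by move: Mw; rewrite (ltW wx)/= ltr_norml => /andP[_ /ltW].
rewrite expectB expectD expectZ (expect_cst (qP n)).
have W2 : expect (@q n) (fun w => W w ^+ 2) <= B.
  by near: n; exact: second_moment_near.
have W2e : e / 2 / B * expect (@q n) (fun w => W w ^+ 2) <= e / 2.
  by rewrite mulrAC ler_pdivrMr ?(lt_le_trans _ B_ge1)// ler_wpM2l// ltW.
have : `|normal_mean s g - expect (@q n) (fun w => g (W w))| <= e / 2.
  by near: n.
by rewrite ler_norml => /andP[+ _]; lra.
Unshelve. all: by end_near. Qed.

(** The two bounds involve the normal distribution function at [x - d] and
    [x + d]; its continuity at [x] closes the gap as [d] tends to 0. *)
Theorem stein_cvg_cdf x :
  {for x, continuous (fun y => normal_prob 0 s `]-oo, y])} ->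
  expect (@q n) (fun w => (W w <= x)%R%:R) @[n --> \oo] --> Phi x.
Proof.
move=> cx; have cPhi : Phi y @[y --> x] --> Phi x.
  apply: fine_cvg; rewrite fineK; first exact: cx.
  by apply: fin_num_measure; exact: measurable_itv.
apply/cvgrPdist_le => e e0; have e20 : 0 < e / 2 by rewrite divr_gt0.
move/cvgrPdist_le : cPhi => /(_ _ e20)/nbhs_ballP[r /= r0 rPhi].
have d0 : 0 < r / 2 by rewrite divr_gt0.
have xd1 : ball x r (x + r / 2).
  by rewrite /ball/= opprD addrA subrr add0r normrN ger0_norm ?ltW//; lra.
have xd2 : ball x r (x - r / 2).
  by rewrite /ball/= opprB addrC subrK ger0_norm ?ltW//; lra.
move: (rPhi _ xd1) (rPhi _ xd2) => /= up lo.
near=> n.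
have : expect (@q n) (fun w => (W w <= x)%R%:R) <= Phi (x + r / 2) + e / 2.
  by near: n; exact: cdf_upper.
have : Phi (x - r / 2) - e / 2 <= expect (@q n) (fun w => (W w <= x)%R%:R).
  by near: n; exact: cdf_lower.
move: up lo; rewrite !ler_norml => /andP[? ?] /andP[? ?] ? ?.
by apply/andP; split; lra.
Unshelve. all: by end_near. Qed.

End SteinCriterion.

(** * Edges as pairs of vertices *)

Local Open Scope ring_scope.

Section EdgeCount.
Context (n : nat) (F : {set {set 'I_n}}).
Hypothesis F2 : forall e, e \in F -> #|e| = 2%N.

Lemma sum_edges_lt :
  (\sum_(i < n) \sum_(j < n | i < j) ([set i; j]%SET \in F) = #|F|)%N.
Proof.
pose S := [set ij : 'I_n * 'I_n | (ij.1 < ij.2)%N &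
  [set ij.1; ij.2]%SET \in F]%SET.
have FE : F = [set [set ij.1; ij.2]%SET | ij in S]%SET.
  apply/setP => e; apply/idP/imsetP => [eF|[ij]]; last by rewrite inE => /andP[_] + ->.
  have /eqP/cards2P[i [j [ij eE]]] := F2 eF.
  have : (i < j)%N || (j < i)%N by rewrite -neq_ltn.
  case/orP => lt_ij; [exists (i, j) => //|exists (j, i)].
  - by rewrite inE/= lt_ij -eE.
  - by rewrite inE/= lt_ij finset.setUC -eE.
  - by rewrite finset.setUC.
rewrite [in RHS]FE card_in_imset; last first.
  move=> [i j] [k l]; rewrite !inE/= => /andP[ij _] /andP[kl _] E.
  have ik : i \in [set k; l]%SET by rewrite -E !inE eqxx.
  have jk : j \in [set k; l]%SET by rewrite -E !inE eqxx orbT.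
  move: ik jk; rewrite !inE => /orP[]/eqP ik /orP[]/eqP jk; rewrite ik jk// in ij *; lia.
rewrite pair_big_dep -sum1_card big_mkcond [RHS]big_mkcond /=.
by apply: eq_bigr => ij _; rewrite /S inE; case: (ij.1 < ij.2)%N => //=; case: (_ \in F).
Qed.

Lemma sum_edges_neq :
  (\sum_(i < n) \sum_(j < n | i != j) ([set i; j]%SET \in F) = 2 * #|F|)%N.
Proof.
transitivity (\sum_(i < n) (\sum_(j < n | i < j) ([set i; j]%SET \in F) +
    \sum_(j < n | j < i) ([set i; j]%SET \in F)))%N.
  apply: eq_bigr => i _; rewrite (bigID (fun j : 'I_n => (i < j)%N)) /=.
  by congr addn; apply: eq_bigl => j; rewrite -val_eqE /=; lia.
rewrite big_split /= sum_edges_lt.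
transitivity (#|F| + \sum_(i < n) \sum_(j < n | i < j) ([set i; j]%SET \in F))%N.
  congr addn; rewrite (exchange_big_dep xpredT)//=; apply: eq_bigr => i _.
  by apply: eq_bigr => j _; rewrite finset.setUC.
by rewrite sum_edges_lt mul2n addnn.
Qed.

End EdgeCount.

(** * The law of a random graph *)

Section GraphLaw.
Context (d : measure_display) (T : measurableType d) (R : realType) (n : nat).
Variables (P : probability T R) (G : random_graph T n).
Local Notation graph := {set {set 'I_n}}.

Definition law (F : graph) : R := fine (P (G @^-1` [set F])).

Lemma edge_indicatorE i j w :
  edge_indicator R G i j w = ([set i; j]%SET \in G w)%:R.
Proof.
rewrite /edge_indicator indicE; congr ((nat_of_bool _)%:R).
by apply/idP/idP; rewrite inE.
Qed.

Lemma graph_measurable_fun (phi : graph -> R) :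
  measurable_fun setT (fun w => phi (G w)).
Proof.
move=> _ B mB; rewrite setTI.
exact: (edges_measurable G (phi @^-1` B)).
Qed.

Lemma expectation_law (phi : graph -> R) :
  ('E_P[fun w => phi (G w)] = (expect law phi)%:E)%E.
Proof.
have mG F : measurable (G @^-1` [set F]) by exact: edges_measurable.
rewrite unlock /expect -sumEFin.
transitivity (\int[P]_w (\sum_F ((phi F)%:E * (\1_(G @^-1` [set F]) w)%:E)))%E.
  apply: eq_integral => w _; rewrite (bigD1 (G w))//= big1 => [|F FG].
    by rewrite indicE mem_set//= mule1 adde0.
  by rewrite indicE memNset ?mule0// => GF; rewrite -GF eqxx in FG.
rewrite integral_sum//=; last first.
  by move=> F; apply: integrableZl => //; exact: integrable_indic.
apply: eq_bigr => F _; rewrite integralZl//; last exact: integrable_indic.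
by rewrite integral_indic//= setIT /law mulrC EFinM fineK ?fin_num_measure.
Qed.

Lemma prob_law (S : set graph) :
  P (G @^-1` S) = (expect law (fun F => (F \in S)%:R))%:E.
Proof.
rewrite -expectation_law -expectation_indic; last exact: edges_measurable.
by congr expectation; apply/funext => w; rewrite indicE mem_preimage.
Qed.

Lemma law_distribution : is_distribution law.
Proof.
split=> [F|]; first by rewrite fine_ge0.
have := prob_law setT; rewrite preimage_setT probability_setT => -[].
rewrite /expect => E; rewrite [RHS]E; apply: eq_bigr => F _.
by rewrite in_setT mulr1.
Qed.

(** Edge set of the induced subgraph on [U]. Sets that are not pairs are dropped
    because no indicator [h_ij] sees them. *)
Definition induced (U : {set 'I_n}) (F : graph) : graph :=
  [set e in F | (e \subset U) && (#|e| == 2)]%SET.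

Lemma inducedK U F : induced U (induced U F) = induced U F.
Proof.
apply/setP => e; rewrite !inE.
by case: (e \in F) => //=; case: (e \subset U) => //=; case: (#|e| == 2).
Qed.

Lemma in_induced (U : {set 'I_n}) (F : graph) i j : i \in U -> j \in U -> i != j ->
  ([set i; j]%SET \in induced U F) = ([set i; j]%SET \in F).
Proof.
move=> iU jU ij; rewrite !inE cards2 ij eqxx andbT.
have -> : [set i; j]%SET \subset U; last by rewrite andbT.
by apply/fintype.subsetP => x; rewrite !inE => /orP[]/eqP ->.
Qed.

(** The induced subgraph is a given graph exactly when finitely many indicators
    [h_ij] with [i], [j] in [U] have prescribed values. *)
Lemma induced_event_measurable (U : {set 'I_n}) (A : graph) :
  sigma_family (pairs_in U) (fun ij => edge_indicator R G ij.1 ij.2)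
    [set w | induced U (G w) = A].
Proof.
rewrite /sigma_family; set Sg := \bigcup_(ij in _) _.
have [AU|AU] := eqVneq (induced U A) A; last first.
  rewrite (_ : [set w | _] = set0); first exact: (@measurable0 _ (g_sigma_algebraType Sg)).
  apply/seteqP; split => // w /= wA; move: AU.
  by rewrite -wA inducedK eqxx.
pose h (ij : 'I_n * 'I_n) := edge_indicator R G ij.1 ij.2.
have -> : [set w | induced U (G w) = A] = \bigcap_(ij in pairs_in U)
    (h ij @^-1` [set ([set ij.1; ij.2]%SET \in A)%:R]).
  apply/seteqP; split => w /=.
    move=> wA [i j] [/= iU jU ij]; rewrite /h/= edge_indicatorE.
    by rewrite -wA in_induced.
  move=> wA; rewrite -AU; apply/setP => e; rewrite !inE.
  have [eU|] := boolP (e \subset U); rewrite ?andbF//=.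
  have [/cards2P[i [j [ij eE]]]|] := boolP (#|e| == 2); rewrite ?andbF ?andbT//.
  have iU : i \in U by apply: (fintype.subsetP eU); rewrite eE !inE eqxx.
  have jU : j \in U by apply: (fintype.subsetP eU); rewrite eE !inE eqxx orbT.
  have := wA (i, j); rewrite /h/= edge_indicatorE -eE => /(_ (And3 iU jU ij))/eqP.
  by rewrite eqr_nat => /eqP; case: (e \in A); case: (e \in G w).
apply: (@fin_bigcap_measurable _ (g_sigma_algebraType Sg)).
  exact: finite_finset.
move=> ij ijU; apply: sub_sigma_algebra; exists ij => //.
by exists [set ([set ij.1; ij.2]%SET \in A)%:R] => //; rewrite setTI.
Qed.

Hypothesis Gind : disjoint_edges_independent (R := R) P G.

Lemma induced_independent (U V : {set 'I_n}) (A B : graph) :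
  (U :&: V = finset.set0)%SET ->
  expect law (fun F => (induced U F == A)%:R * (induced V F == B)%:R) =
  expect law (fun F => (induced U F == A)%:R) *
  expect law (fun F => (induced V F == B)%:R).
Proof.
move=> UV; have evE (phi : graph -> bool) :
    P [set w | phi (G w)] = (expect law (fun F => (phi F)%:R))%:E.
  have := prob_law [set F | phi F]; rewrite /preimage/= => ->.
  congr EFin; apply: eq_expect => F; congr ((nat_of_bool _)%:R).
  by apply/idP/idP; rewrite inE.
have := Gind UV (@induced_event_measurable U A) (@induced_event_measurable V B).
have eqE W C : [set w | induced W (G w) = C] = [set w | induced W (G w) == C].
  by apply/seteqP; split=> w /= /eqP.
rewrite !eqE.
have -> : [set w | induced U (G w) == A] `&` [set w | induced V (G w) == B] =
    [set w | (induced U (G w) == A) && (induced V (G w) == B)].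
  by apply/seteqP; split => w /= /andP.
rewrite (evE (fun F => (induced U F == A) && (induced V F == B))).
rewrite (evE (fun F => induced U F == A)) (evE (fun F => induced V F == B)).
rewrite -EFinM => -[<-].
by apply: eq_expect => F; rewrite -natrM mulnb.
Qed.

Variable p : R.

Definition centered_edge (i j : 'I_n) (F : graph) : R :=
  if i == j then 0 else ([set i; j]%SET \in F)%:R - p.

Lemma depends_on_induced (U : {set 'I_n}) (Y : graph -> R) :
  depends_on centered_edge U Y -> forall F, Y F = Y (induced U F).
Proof.
move=> YU F; apply: YU => i j iU jU; rewrite /centered_edge.
by case: eqVneq => // ij; rewrite in_induced.
Qed.

(** A function of the entries inside [U] is a finite linear combination of the
    indicators of the values of the induced subgraph on [U], so independence of
    events extends to products of functions by bilinearity. *)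
Lemma centered_edge_dissociated : dissociated law centered_edge.
Proof.
move=> U V Y Z UV YU ZV.
have dec W (C : graph -> R) F : C (induced W F) =
    \sum_A C A * (induced W F == A)%:R.
  rewrite (bigD1 (induced W F))//= eqxx mulr1 big1 ?addr0// => A /negbTE.
  by rewrite eq_sym => ->; rewrite mulr0.
have EYZ : expect law (fun F => Y F * Z F) = expect law (fun F => \sum_A \sum_B
    Y A * Z B * ((induced U F == A)%:R * (induced V F == B)%:R)).
  apply: eq_expect => F; rewrite (depends_on_induced YU) (depends_on_induced ZV).
  rewrite (dec U) (dec V) mulr_suml; apply: eq_bigr => A _.
  by rewrite mulr_sumr; apply: eq_bigr => B _; ring.
rewrite EYZ (eq_expect _ (depends_on_induced YU)) (eq_expect _ (depends_on_induced ZV)).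
rewrite (eq_expect _ (dec U Y)) (eq_expect _ (dec V Z)) !expect_sum mulr_suml.
apply: eq_bigr => A _; rewrite expect_sum mulr_sumr; apply: eq_bigr => B _.
by rewrite !expectZ (induced_independent A B UV); ring.
Qed.

Lemma edge_probE i j : edge_prob P G i j = p%:E ->
  expect law (fun F => ([set i; j]%SET \in F)%:R) = p.
Proof.
rewrite /edge_prob (_ : edge_event G i j =
  G @^-1` [set F : {set {set 'I_n}} | [set i; j]%SET \in F])//.
rewrite prob_law => -[<-]; apply: eq_expect => F.
by congr ((nat_of_bool _)%:R); apply/idP/idP; rewrite inE.
Qed.

Hypothesis Gp : forall i j : 'I_n, i != j -> edge_prob P G i j = p%:E.

Lemma centered_edge_mean i j : expect law (centered_edge i j) = 0.
Proof.
rewrite /centered_edge; have [_|ij] := eqVneq i j.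
  exact: (expect_cst law_distribution).
by rewrite expectB (expect_cst law_distribution) edge_probE ?subrr// Gp.
Qed.

Lemma norm_centered_edge i j F : `|centered_edge i j F| <= 1.
Proof.
rewrite /centered_edge; have [_|/Gp pE] := eqVneq i j; first by rewrite normr0.
have p0 : 0 <= p by rewrite -lee_fin -pE /edge_prob measure_ge0.
have p1 : p <= 1.
  rewrite -lee_fin -pE; apply: probability_le1.
  exact: (edges_measurable G [set F : {set {set 'I_n}} | [set i; j]%SET \in F]).
by rewrite ler_norml; case: (_ \in F) => /=; apply/andP; split; lra.
Qed.

Lemma covariance_centered_edge i j k : i != j -> i != k ->
  covariance P (edge_indicator R G i j) (edge_indicator R G i k) =
  (expect law (fun F => centered_edge i j F * centered_edge i k F))%:E.
Proof.
have EE a c : a != c -> ('E_P[edge_indicator R G a c] = p%:E)%E.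
  move=> ac; rewrite -(edge_probE (Gp ac)) -expectation_law; congr expectation.
  by apply/funext => w; exact: edge_indicatorE.
move=> ij ik; rewrite unlock !EE// -expectation_law; congr expectation.
apply/funext => w; rewrite /centered_edge (negbTE ij) (negbTE ik).
by rewrite -!edge_indicatorE.
Qed.

Lemma total_centered_edge w :
  total centered_edge (G w) = 2 * #|G w|%:R - n%:R * (n%:R - 1) * p.
Proof.
have Gw2 e : e \in G w -> #|e| = 2%N by exact: edges_card2.
rewrite -natrM -(sum_edges_neq Gw2) natr_sum /total.
have -> : n%:R * (n%:R - 1) * p = \sum_(i < n) \sum_(j < n | i != j) p.
  under eq_bigr => i _.
    rewrite sumr_const (_ : #|_| = n.-1); last first.
      rewrite (eq_card (B := predC1 i)) ?cardC1 ?card_ord// => j.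
      by rewrite !inE eq_sym.
    over.
  rewrite sumr_const card_ord -mulrnA -[RHS]mulr_natl natrM.
  have [->|n0] := posnP n; first by rewrite !(mul0r, mulr0).
  by rewrite -subn1 natrB//; ring.
rewrite -sumrB; apply: eq_bigr => i _; rewrite natr_sum -sumrB.
rewrite [RHS]big_mkcond; apply: eq_bigr => j _.
by rewrite /centered_edge; case: eqVneq.
Qed.

Definition edge_scale : R := Num.sqrt n%:R / (n%:R * (n%:R - 1)).

Lemma edge_density_scaled w : (1 < n)%N ->
  Num.sqrt n%:R * (edge_density R G w - p) =
  edge_scale * total centered_edge (G w).
Proof.
move=> n1; have n2 : 2 <= n%:R :> R by rewrite ler_nat.
rewrite total_centered_edge /edge_scale /edge_density natrM.
by field; rewrite !gt_eqF//; lra.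
Qed.

End GraphLaw.

Lemma cvg_div_sqrtn (R : realType) (u : R^nat) (K : R) :
  (forall n, (1 < n)%N -> `|u n| <= K / Num.sqrt n%:R) -> u n @[n --> \oo] --> (0 : R).
Proof.
move=> uK; apply/cvgrPdist_le => e e0; near=> n.
have n1 : (1 < n)%N by near: n; exact: nbhs_infty_gt.
rewrite sub0r normrN; apply: le_trans (uK n n1) _.
have sn : 0 < Num.sqrt n%:R :> R by rewrite sqrtr_gt0 ltr0n ltnW.
rewrite ler_pdivrMr// mulrC -ler_pdivrMr//.
apply: le_trans (ler_norm _) _; rewrite -sqrtr_sqr ler_wsqrtr//.
by near: n; exact: nbhs_infty_ger.
Unshelve. all: by end_near. Qed.

(** * Edge density as an estimator of the edge probability *)

Theorem theorem2p1 (R : realType) :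
  (forall (n : nat) (d : measure_display) (T : measurableType d)
      (P : probability T R) (G : random_graph T n),
    (1 < n)%N ->
    is_ustatistic2 (edge_indicator R G) (edge_density R G) /\
    (forall p : R,
      (forall i j : 'I_n, i != j -> edge_prob P G i j = p%:E) ->
      unbiased_estimator P (edge_density R G) p)) /\
  (forall (d : nat -> measure_display) (T : forall n, measurableType (d n))
      (P : forall n, probability (T n) R) (G : forall n, random_graph (T n) n)
      (p nu : R),
    (forall (n : nat) (i j k l : 'I_n), i != j -> k != l ->
      identically_distributed (P n)
        (edge_indicator R (G n) i j) (edge_indicator R (G n) k l)) ->
    (forall (n : nat) (i j : 'I_n), i != j ->
      edge_prob (P n) (G n) i j = p%:E) ->
    (forall n : nat, disjoint_edges_independent (P n) (G n)) ->
    0 < nu ->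
    (forall (n : nat) (i j k : 'I_n), i != j -> i != k -> j != k ->
      covariance (P n) (edge_indicator R (G n) i j)
        (edge_indicator R (G n) i k) = nu%:E) ->
    cvg_in_law P
      (fun n w => Num.sqrt n%:R * (edge_density R (G n) w - p))
      (normal_prob 0 (Num.sqrt (4 * nu)))).
Proof.
split=> [n d T P G n1|d T P G p nu _ Gp Gind nu0 Gnu].
  have n2 : 2 <= n%:R :> R by rewrite ler_nat.
  split.
    split=> [i j _|i j _|w].
    - rewrite (_ : edge_indicator R G i j =
        (fun w => ([set i; j]%SET \in G w)%:R)); last first.
        by apply/funext => w; exact: edge_indicatorE.
      exact: (graph_measurable_fun G (fun F => ([set i; j]%SET \in F)%:R)).
    - by apply/funext => w; rewrite !edge_indicatorE finset.setUC.
    - under eq_bigr do under eq_bigr do rewrite edge_indicatorE.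
      under eq_bigr do rewrite -natr_sum.
      rewrite -natr_sum sum_edges_lt => [|e]; last exact: edges_card2.
      have C2 : 2 * 'C(n, 2)%:R = n%:R * (n%:R - 1) :> R.
        by rewrite -natrM -mul_bin_diag bin1 natrM -subn1 natrB// ltnW.
      have C0 : 'C(n, 2)%:R != 0 :> R by rewrite pnatr_eq0 -lt0n bin_gt0.
      by rewrite /edge_density natrM -C2; field; rewrite C0.
  move=> p Gp; split; first exact: (graph_measurable_fun G
    (fun F => (2 * #|F|)%:R / (n%:R * (n%:R - 1)))).
  have -> : edge_density R G = (fun w =>
      (n%:R * (n%:R - 1))^-1 * total (centered_edge p) (G w) + p).
    apply/funext => w; rewrite total_centered_edge /edge_density natrM; field.
    by rewrite !gt_eqF//; lra.
  have lawP := law_distribution P G.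
  rewrite (expectation_law P G (fun F =>
    (n%:R * (n%:R - 1))^-1 * total (centered_edge p) F + p)).
  rewrite expectD expectZ (expect_cst lawP) /total expect_sum.
  rewrite big1 ?mulr0 ?add0r// => i _; rewrite expect_sum big1// => j _.
  exact: centered_edge_mean.
have s0 : 0 < Num.sqrt (4 * nu) by rewrite sqrtr_gt0 mulr_gt0.
split=> [n|x cx].
  exact: (graph_measurable_fun (G n) (fun F =>
    Num.sqrt n%:R * ((2 * #|F|)%:R / (n%:R * (n%:R - 1)) - p))).
pose W n (F : {set {set 'I_n}}) := edge_scale R n * total (centered_edge p) F.
have lawP n := law_distribution (P n) (G n).
have W_stein (f f' : R -> R) (C1 C2 : R) :
    (forall x, `|f' x| <= C1) -> 0 <= C2 ->
    (forall x y, `|f y - f x - f' x * (y - x)| <= C2 * (y - x) ^+ 2) ->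
    expect (law (P n) (G n)) (fun F => W n F * f (W n F)) -
    Num.sqrt (4 * nu) ^+ 2 * expect (law (P n) (G n)) (fun F => f' (W n F))
    @[n --> \oo] --> (0 : R).
  move=> f'C C20 ff'; rewrite sqr_sqrtr ?mulr_ge0 ?(ltW nu0)//.
  apply: (cvg_div_sqrtn (K := 288 * C2 + (104 + 8 * `|nu|) * C1)) => n n1.
  have n2 : 2 <= n%:R :> R by rewrite ler_nat.
  apply: (stein_bound (lawP n)) => //.
  - by move=> i j F; rewrite /centered_edge eq_sym finset.setUC.
  - by move=> i F; rewrite /centered_edge eqxx.
  - exact: (norm_centered_edge (Gp n)).
  - exact: centered_edge_dissociated.
  - by rewrite divr_ge0 ?sqrtr_ge0// mulr_ge0//; lra.
  - exact: (centered_edge_mean (Gp n)).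
  - move=> i j k ij ik jk; apply: EFin_inj.
    by rewrite -(covariance_centered_edge (Gp n))// Gnu.
have := stein_cvg_cdf s0 lawP W_stein cx.
move=> cdf_cvg; rewrite -[X in _ --> X]fineK; last first.
  by apply: fin_num_measure; exact: measurable_itv.
have eventE n : (1 < n)%N ->
    P n ((fun w => Num.sqrt n%:R * (edge_density R (G n) w - p)) @^-1` `]-oo, x]) =
    (expect (law (P n) (G n)) (fun F => (W n F <= x)%R%:R))%:E.
  move=> n1; rewrite (_ : _ @^-1` _ = G n @^-1` [set F | W n F <= x]).
    rewrite prob_law /=; congr EFin; apply: eq_expect => F.
    by congr ((nat_of_bool _)%:R); apply/idP/idP; rewrite inE.
  by apply/seteqP; split => w; rewrite /= in_itv/= edge_density_scaled.
apply/fine_cvgP; split; first by exists 2%N => // n /eventE ->.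
by apply: cvg_trans cdf_cvg; apply: near_eq_cvg; exists 2%N => // n /eventE /= ->.
Qed.
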